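(* For $s>3/2$ and $T>0$ there is a constant $c(T,s)$ such that for all $E_0\in H^s(\mathbb R^3)$ $$\|\mathcal E(t)E_0\|_{L^2_xL^\infty_{yzT}}\le c(T,s)\,\|E_0\|_{H^s(\mathbb R^3)}.$$ The same estimate holds exchanging $x$ and $y$, that is, with $L^2_yL^\infty_{xzT}$ on the left-hand side.
   Context: Points of $\mathbb R^3$ are $(x,y,z)$ with dual variables $\xi=(\xi_1,\xi_2,\xi_3)$. $\mathcal E(t)$ is the unitary group $\mathcal E(t)f=\big(e^{-it(\xi_1^2+\xi_2^2+\xi_3)}\widehat f(\xi)\big)^\vee$, where $\widehat{\ }$ and ${}^\vee$ denote the spatial Fourier transform and its inverse (it solves $\partial_tE+\partial_zE-i(\partial_x^2+\partial_y^2)E=0$, $E(0)=f$). $H^s(\mathbb R^3)$ is the usual $L^2$-based Sobolev space. $\|f\|_{L^2_xL^\infty_{yzT}}=\big(\int_{\mathbb R}\sup_{y,z\in\mathbb R,\,t\in[0,T]}|f(x,y,z,t)|^2\,dx\big)^{1/2}$ (essential supremum), and similarly with $x$ and $y$ exchanged. *)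

(* Defs.v *)
From mathcomp Require Import all_boot all_order all_algebra.
From mathcomp Require Import all_classical all_reals all_analysis.
From mathcomp Require Import complex.

Set Implicit Arguments.
Unset Strict Implicit.
Unset Printing Implicit Defensive.

Import Order.TTheory GRing.Theory Num.Theory.
Import numFieldNormedType.Exports.
Import ComplexField.Normc.

Local Open Scope classical_set_scope.
Local Open Scope ring_scope.
Local Open Scope complex_scope.

(* Points of R^3 are nested pairs: (x, y, z) is ((x, y), z). *)
Notation R3 R :=
  (measurableTypeR R * measurableTypeR R * measurableTypeR R)%type.

Notation leb3 R :=
  ((@lebesgue_measure R \x @lebesgue_measure R) \x @lebesgue_measure R)%E.

Definition dot3 (R : realType) (v w : R3 R) : R :=
  v.1.1 * w.1.1 + v.1.2 * w.1.2 + v.2 * w.2.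

Definition expi (R : realType) (a : R) : R[i] := cos a +i* sin a.

(* R[i] carries no sigma-algebra or integral in the library: measurability,
   integrability and integrals are taken componentwise. *)
Definition cmeasurable (R : realType) (f : R3 R -> R[i]) : Prop :=
  measurable_fun setT (fun v => complex.Re (f v)) /\
  measurable_fun setT (fun v => complex.Im (f v)).

Definition cintegrable (R : realType) (f : R3 R -> R[i]) : Prop :=
  (leb3 R).-integrable setT (fun v => (complex.Re (f v))%:E) /\
  (leb3 R).-integrable setT (fun v => (complex.Im (f v))%:E).

Definition cintegral (R : realType) (f : R3 R -> R[i]) : R[i] :=
  (\int[leb3 R]_v complex.Re (f v)) +i* (\int[leb3 R]_v complex.Im (f v)).

Definition L2norm (R : realType) (f : R3 R -> R[i]) : \bar R :=
  Lnorm (leb3 R) 2%:E (fun v => (normc (f v))%:E).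

Definition L2 (R : realType) : set (R3 R -> R[i]) :=
  [set f | cmeasurable f /\ (L2norm f < +oo)%E].

(* (2 pi)^(-3/2) \int e^(i sg v.w) f(v) dv, for f integrable; sg = -1 for the
   Fourier transform, sg = 1 for its inverse. *)
Definition fourier_integral (R : realType) (sg : R) (f : R3 R -> R[i])
    (w : R3 R) : R[i] :=
  (((2 * pi) `^ (- (3 / 2)))%:C) *
  cintegral (fun v => expi (sg * dot3 v w) * f v).

Definition truncate (R : realType) (n : nat) (f : R3 R -> R[i])
    (v : R3 R) : R[i] :=
  if dot3 v v <= n%:R ^+ 2 then f v else 0.

(* On L^1 this is the Fourier integral.  On L^2 functions that are not
   integrable it is the Plancherel extension, i.e. (a representative of) the
   L^2-limit of the Fourier integrals of the truncations of f to balls.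
   The value is only meaningful for f in L^1 or L^2. *)
Definition fourier_transform (R : realType) (sg : R) (f : R3 R -> R[i]) :
    R3 R -> R[i] :=
  if `[< cintegrable f >] then fourier_integral sg f
  else xget (fun=> 0)
    [set g | L2 g /\
       L2norm (fun w => fourier_integral sg (truncate n f) w - g w)
         @[n --> \oo] --> 0%E].

Definition fourier (R : realType) (f : R3 R -> R[i]) :=
  fourier_transform (-1) f.

Definition inv_fourier (R : realType) (f : R3 R -> R[i]) :=
  fourier_transform 1 f.

Definition sobolev_norm (R : realType) (s : R) (f : R3 R -> R[i]) : \bar R :=
  L2norm (fun w => ((1 + dot3 w w) `^ (s / 2))%:C * fourier f w).

(* For s >= 0, where H^s is a subspace of L^2. *)
Definition sobolev (R : realType) (s : R) : set (R3 R -> R[i]) :=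
  [set f | L2 f /\ (sobolev_norm s f < +oo)%E].

(* When the Fourier transform of f is integrable (in particular for f in H^s,
   s > 3/2) this is given at every (t, x, y, z) by an absolutely convergent
   integral, so it is the jointly continuous representative of E(t) f. *)
Definition unitary_group (R : realType) (t : R) (f : R3 R -> R[i]) :
    R3 R -> R[i] :=
  inv_fourier (fun w : R3 R =>
    expi (- (t * (w.1.1 ^+ 2 + w.1.2 ^+ 2 + w.2))) * fourier f w).

Lemma measurable_slab (R : realType) (T : R) :
  measurable (setT `*` `[0, T]%classic : set (R3 R)).
Proof. by apply: measurableX => //; exact: measurable_itv. Qed.

(* Lebesgue measure on R x R x [0, T]. *)
Definition leb_slab (R : realType) (T : R) : {measure set (R3 R) -> \bar R} :=
  mrestr (leb3 R) (measurable_slab T).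

(* The library norm of exponent +oo is the essential supremum. *)
Definition norm_L2x_LinfyzT (R : realType) (T : R)
    (u : R -> R3 R -> R[i]) : \bar R :=
  Lnorm (@lebesgue_measure R) 2%:E (fun x : measurableTypeR R =>
    Lnorm (leb_slab T) +oo%E (fun p : R3 R =>
      let: (y, z, t) := p in (normc (u t (x, y, z)))%:E)).

Definition norm_L2y_LinfxzT (R : realType) (T : R)
    (u : R -> R3 R -> R[i]) : \bar R :=
  Lnorm (@lebesgue_measure R) 2%:E (fun y : measurableTypeR R =>
    Lnorm (leb_slab T) +oo%E (fun p : R3 R =>
      let: (x, z, t) := p in (normc (u t (x, y, z)))%:E)).

(* Main.v *)
From HB Require Import structures.
Require Import Defs.
From mathcomp Require Import all_boot all_order all_algebra.
From mathcomp Require Import all_classical all_reals all_analysis.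
From mathcomp Require Import complex.
From mathcomp Require Import measurable_realfun ess_sup_inf.
From mathcomp Require Import ring lra.

(** Let [g] be the Fourier transform of [E0].  As [s > 3/2], the Sobolev norm
    controls [\int |g|^2 / W] with [W(xi) = w(xi1) w(xi2) w(xi3)],
    [w(r) = (1 + r^2)^(-s/3)] integrable; hence [g] is integrable and [E(t) E0] is
    given by an absolutely convergent integral.  The maximal function is linearized:
    [y], [z] and [t] become measurable functions of [x], which by continuity need only
    run through a countable grid.  By duality, the L^2 bound for the linearized
    operator reduces to the integrability in [x] of the supremum over [t] of the
    kernel [\int exp(i (x r - t r^2)) w(r) dr].  The weight [w] is dominated by
    a series of Gaussians [4^(-s k / 3) exp(- 4^(-k) r^2)], and for a Gaussian
    [exp (- e r^2)] the modulus of the kernel is explicit: up to a constant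
    [rho^(-1/4) exp (- e x^2 / (4 rho))] with [rho = e^2 + t^2].  Its supremum over
    bounded [t] has integral [O(e^(-1/2))], and the resulting series
    [\sum 4^(-s k / 3) 2^k] converges because [s / 3 > 1/2].  All functions are split
    into real and imaginary parts, so that only real cosine integrals occur. *)

Set Implicit Arguments.
Unset Strict Implicit.
Unset Printing Implicit Defensive.

Import Order.TTheory GRing.Theory Num.Theory.
Import numFieldNormedType.Exports.
Import ComplexField.Normc.

Local Open Scope classical_set_scope.
Local Open Scope ring_scope.
Local Open Scope complex_scope.

(** * Gaussian integrals *)

Section gauss.
Context {R : realType}.
Notation mu := (@lebesgue_measure R).

(** An oscillatory kernel is not monotone in its weight, so [w] cannot be replaced by Gaussians
    inside the kernel. The replacement is made on the quadratic form: after duality the weight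
    multiplies the square of the adjoint, a pointwise larger weight only increases the integral, and
    each Gaussian needs its own kernel estimate. Only the distinguished variable is treated this
    way; the two others contribute their mass alone, their phases being absorbed in a phase shift
    over which every bound is uniform. The Gaussian kernel is found without contour integrals:
    integration by parts and differentiation under the integral give linear differential equations
    in [a] and [t] for its squared modulus. Real cosines have one price: a product of two of them
    involves the sum of the phases besides their difference, hence kernels at [x - y] and at
    [x + y], with times up to [2 T]. The exponent [s / 3] shares the Sobolev weight equally among
    three variables, and [s > 3/2] says exactly that the ratio [2 * 4^(-s/3)] is below 1. *)

Definition gauss (e x : R) : R := expR (- (e * x ^+ 2)).

Lemma gauss_ge0 e x : 0 <= gauss e x. Proof. exact: expR_ge0. Qed.

Lemma measurable_gauss e : measurable_fun [set: measurableTypeR R] (gauss e).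
Proof.
apply: measurableT_comp => //; apply: measurableT_comp => //.
by apply: measurable_funM => //; exact: measurable_funX.
Qed.

(** The normal density of mean [m] and variance [1 / (2 e)] has mass one and is this Gaussian times
    its peak value. *)
Lemma integral_gauss_shift e m : 0 < e ->
  (\int[mu]_x (gauss e (x - m))%:E)%E = (Num.sqrt (pi / e))%:E.
Proof.
move=> e0; pose s : R := Num.sqrt ((2 * e)^-1).
have s2 : s ^+ 2 = (2 * e)^-1.
  by rewrite sqr_sqrtr// invr_ge0 mulr_ge0// ltW.
have s0 : s != 0 by rewrite gt_eqF// sqrtr_gt0 invr_gt0 mulr_gt0.
have := integral_normal_pdf m s.
rewrite normal_pdfE//.
have E x : normal_fun m s x = gauss e (x - m).
  rewrite /normal_fun /gauss; congr (expR _).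
  by rewrite -mulr_natr s2; field; rewrite gt_eqF.
under eq_integral do rewrite E EFinM.
rewrite ge0_integralZl_EFin//; last 3 first.
- by move=> x _; rewrite lee_fin gauss_ge0.
- apply/measurable_EFinP; apply: measurableT_comp; first exact: measurable_gauss.
  exact: measurable_funB.
- exact: normal_peak_ge0.
set I := (\int[_]_x _)%E => H.
have pk : normal_peak s != 0 by rewrite gt_eqF// normal_peak_gt0.
have : ((normal_peak s)^-1%:E * ((normal_peak s)%:E * I) = (normal_peak s)^-1%:E)%E.
  by rewrite H mule1.
rewrite muleA -EFinM mulVf// mul1e => ->.
by rewrite /normal_peak invrK s2 -mulr_natr; congr ((Num.sqrt _)%:E); field; rewrite gt_eqF.
Qed.

Lemma integral_gauss e : 0 < e ->
  (\int[mu]_x (gauss e x)%:E)%E = (Num.sqrt (pi / e))%:E.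
Proof.
by move=> e0; rewrite -(integral_gauss_shift 0 e0); under [RHS]eq_integral do rewrite subr0.
Qed.

Lemma integrable_gauss e : 0 < e -> mu.-integrable setT (EFin \o gauss e).
Proof.
move=> e0; apply/integrableP; split.
  by apply/measurable_EFinP; exact: measurable_gauss.
under eq_integral do rewrite /= ger0_norm ?gauss_ge0//.
by rewrite integral_gauss// ltry.
Qed.

(* [1 + e x^2 / 2 <= expR (e x^2 / 2)] absorbs the quadratic factor. *)
Lemma sqr_gauss_le e x : 0 < e ->
  (1 + x ^+ 2) * gauss e x <= (1 + 2 / e) * gauss (e / 2) x.
Proof.
move=> e0; set y := e / 2 * x ^+ 2.
have -> : gauss e x = gauss (e / 2) x * expR (- y).
  by rewrite /gauss -expRD /y; congr expR; field.
have h : 1 + y <= expR y by exact: expR_ge1Dx.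
have y0 : 0 <= y by rewrite /y mulr_ge0 ?sqr_ge0// divr_ge0// ltW.
have xy : x ^+ 2 = 2 / e * y by rewrite /y; field; rewrite gt_eqF.
rewrite mulrCA mulrC ler_wpM2r ?gauss_ge0//.
rewrite expRN ler_pdivrMr ?expR_gt0//.
have e2 : 0 < 2 / e by rewrite divr_gt0.
rewrite xy; apply: (@le_trans _ _ ((1 + 2 / e) * (1 + y))); first by nra.
by rewrite ler_wpM2l// addr_ge0// ltW.
Qed.

Lemma le_integrable_gauss (f : R -> R) e C : 0 < e ->
  measurable_fun [set: measurableTypeR R] f ->
  (forall x, `|f x| <= C * gauss e x) -> mu.-integrable setT (EFin \o f).
Proof.
move=> e0 mf fC.
apply: (@le_integrable _ _ _ mu setT measurableT _ (fun x => C%:E * (gauss e x)%:E)%E).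
- exact/measurable_EFinP.
- by move=> x _; rewrite lee_fin (le_trans (fC x))// ler_norm.
- by apply: integrableZl => //; exact: integrable_gauss.
Qed.

End gauss.

Section real_integrable.
Context d (T : measurableType d) (R : realType) (mu : {measure set T -> \bar R}).
Implicit Types f g : T -> R.

Lemma integrable_realZ (c : R) f : mu.-integrable setT (EFin \o f) ->
  mu.-integrable setT (EFin \o fun x => c * f x).
Proof. by move=> i; exact: (integrableZl measurableT c i). Qed.

Lemma integrable_realD f g : mu.-integrable setT (EFin \o f) ->
  mu.-integrable setT (EFin \o g) ->
  mu.-integrable setT (EFin \o fun x => f x + g x).
Proof. by move=> i j; exact: (integrableD measurableT i j). Qed.

Lemma integrable_realB f g : mu.-integrable setT (EFin \o f) ->
  mu.-integrable setT (EFin \o g) ->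
  mu.-integrable setT (EFin \o fun x => f x - g x).
Proof. by move=> i j; exact: (integrableB measurableT i j). Qed.

End real_integrable.

(** * Derivatives integrated over the whole line *)

Section ftc_line.
Context {R : realType}.
Notation mu := (@lebesgue_measure R).

(** On symmetric intervals the integral is a difference of boundary values tending to 0; dominated
    convergence, with majorant [|h'|], passes to the whole line. It replaces integration by
    parts. *)
Lemma Rintegral_derive_eq0 (h h' : R -> R) :
  (forall x : R, is_derive x (1 : R) h (h' x)) -> continuous h' ->
  mu.-integrable setT (EFin \o h') ->
  h (n.+1%:R) @[n --> \oo] --> (0 : R) -> h (- n.+1%:R) @[n --> \oo] --> (0 : R) ->
  \int[mu]_x h' x = 0.
Proof.
move=> dh ch ih hp hm.
(* The successor keeps the interval nondegenerate, as the fundamental theorem requires. *)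
pose D (n : nat) : set (measurableTypeR R) := `[(- n.+1%:R), n.+1%:R]%classic.
have mD n : measurable (D n) by exact: measurable_itv.
have mh : measurable_fun [set: measurableTypeR R] (EFin \o h') by exact: (measurable_int mu).
have I n : (\int[mu]_(x in D n) (h' x)%:E = (h n.+1%:R)%:E - (h (- n.+1%:R))%:E)%E.
  apply: continuous_FTC2.
  - by rewrite (@lt_le_trans _ _ 0)// oppr_lt0 ltr0n.
  - exact: continuous_subspaceT.
  - have ch0 x : {for x, continuous h}.
      by apply: differentiable_continuous; apply/derivable1_diffP; have [] := dh x.
    split.
    + by move=> x _; have [] := dh x.
    + by apply: cvg_at_right_filter; exact: ch0.
    + by apply: cvg_at_left_filter; exact: ch0.
  - by move=> x _; rewrite derive1E; have [] := dh x.
have [|||||_ _] := @dominated_convergence _ _ _ mu setT measurableT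
  (fun n => (EFin \o h') \_ (D n)) (EFin \o h') (abse \o (EFin \o h')).
- by move=> n; apply/(measurable_restrictT _ (mD n)); exact: measurable_funTS.
- by [].
- apply: aeW => x _ /=.
  have [N hN] : exists N : nat, `|x| <= N%:R.
    by exists (Num.truncn `|x|).+1; rewrite ltW// truncnS_gt.
  apply: (@cvg_near_cst _ _ _ _ _ _).
  near=> n; rewrite /= patchE mem_set// /D/= in_itv/= -ler_norml.
  rewrite (le_trans hN)// ler_nat leqW//; near: n; exact: nbhs_infty_ge.
- exact: integrable_abse.
- apply: aeW => x n _; rewrite /= patchE; case: ifPn => // _.
  by rewrite abse0 lee_fin.
rewrite /=; under eq_fun do rewrite -integral_mkcond I.
move=> H1.
have H2 : ((h n.+1%:R)%:E - (h (- n.+1%:R))%:E)%E @[n --> \oo] --> 0%E.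
  rewrite -[0%E]/((0 : R)%:E) -(subr0 0) EFinB.
  under eq_fun do rewrite -EFinB.
  by apply: cvg_EFin; [exact: nearW | exact: cvgB].
by rewrite /Rintegral (cvg_unique _ H1 H2).
Unshelve. all: end_near. Qed.

End ftc_line.

(** * The kernel of a complex Gaussian *)

Section osc.
Context {R : realType}.
Notation mu := (@lebesgue_measure R).
Implicit Types e a t b x : R.

Definition phase a t b x := a * x - t * x ^+ 2 + b.

(** Real part of [\int x^k exp(i (a x - t x^2 + b) - e x^2) dx]. Differentiation raises [k], and
    moving [b] by [pi / 2] gives minus the imaginary part. *)
Definition osc e (k : nat) a t b : R :=
  \int[mu]_x (x ^+ k * (cos (phase a t b x) * gauss e x)).

Lemma measurable_phase a t b : measurable_fun [set: measurableTypeR R] (phase a t b).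
Proof.
by apply: measurable_funD => //; apply: measurable_funB; apply: measurable_funM.
Qed.

Lemma measurable_cos : measurable_fun [set: measurableTypeR R] (@cos R).
Proof. by apply: continuous_measurable_fun; exact: continuous_cos. Qed.

Lemma osc_integrand_le e k a t b x : 0 < e -> (k <= 2)%N ->
  `|x ^+ k * (cos (phase a t b x) * gauss e x)| <= (1 + 2 / e) * gauss (e / 2) x.
Proof.
move=> e0 k2; apply: le_trans (sqr_gauss_le x e0).
rewrite !normrM (ger0_norm (gauss_ge0 _ _)) mulrA ler_wpM2r ?gauss_ge0//.
rewrite -[leRHS]mulr1 ler_pM ?cos_max// normrX.
have x0 := normr_ge0 x; have x2 : `|x| ^+ 2 = x ^+ 2 by rewrite real_normK ?num_real.
case: k k2 => [|[|[|//]]] _; rewrite ?expr0 ?expr1 -?x2; nra.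
Qed.

Lemma integrable_osc e k a t b : 0 < e -> (k <= 2)%N ->
  mu.-integrable setT (EFin \o fun x => x ^+ k * (cos (phase a t b x) * gauss e x)).
Proof.
move=> e0 k2; apply: (@le_integrable_gauss _ _ (e / 2) (1 + 2 / e)).
- by rewrite divr_gt0.
- apply: measurable_funM; first exact: measurable_funX.
  apply: measurable_funM; last exact: measurable_gauss.
  by apply: measurableT_comp; [exact: measurable_cos|exact: measurable_phase].
- by move=> x; exact: osc_integrand_le.
Qed.

(** By [1 + y <= expR y] the Gaussian at [n.+1] is at most [1 / (e * n.+1)]. Both ends of the line
    are instances of [main], with [s] equal to 1 or -1. *)
Lemma cvg_gauss_nat (h : R -> R) e C : 0 < e -> 0 <= C ->
  (forall x, `|h x| <= C * gauss e x) ->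
  h (n.+1%:R) @[n --> \oo] --> (0 : R) /\ h (- n.+1%:R) @[n --> \oo] --> (0 : R).
Proof.
move=> e0 C0 hC.
have gn n : gauss e n.+1%:R <= e^-1 * n.+1%:R^-1.
  rewrite /gauss expRN -invfM lef_pV2 ?posrE ?expR_gt0 ?mulr_gt0//.
  apply: (@le_trans _ _ (1 + e * n.+1%:R ^+ 2)); last exact: expR_ge1Dx.
  have : (1 : R) <= n.+1%:R by rewrite ler1n.
  nra.
have main (s : R) : s ^+ 2 = 1 -> h (s * n.+1%:R) @[n --> \oo] --> (0 : R).
  move=> s1; apply/norm_cvg0P.
  apply: (@squeeze_cvgr _ _ _ _ (cst 0) (fun n => C * e^-1 * n.+1%:R^-1)).
  - apply: nearW => n; rewrite normr_ge0/= (le_trans (hC _))//.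
    have -> : gauss e (s * n.+1%:R) = gauss e n.+1%:R by rewrite /gauss exprMn s1 mul1r.
    by rewrite -mulrA ler_wpM2l.
  - exact: cvg_cst.
  - rewrite -(mulr0 (C * e^-1)); apply: cvgM; [exact: cvg_cst|exact: cvg_harmonic].
split.
- by under eq_fun do rewrite -[_%:R]mul1r; apply: main; rewrite expr1n.
- by under eq_fun do rewrite -mulN1r; apply: main; rewrite sqrrN expr1n.
Qed.

Lemma phaseDb a t b c x : phase a t (b + c) x = phase a t b x + c.
Proof. by rewrite /phase addrA. Qed.

Lemma is_derive_phase a t b x :
  is_derive x (1 : R) (phase a t b) (a - 2 * t * x).
Proof.
rewrite /phase; apply: is_derive_eq.
by rewrite /GRing.scale/=; ring.
Qed.

Lemma is_derive_gauss e x :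
  is_derive x (1 : R) (gauss e) (- (2 * e * x) * gauss e x).
Proof.
rewrite /gauss.
apply: (@trigger_derive _ _ _ (expR (- (e * x ^+ 2)) * (- (2 * e * x)))); last by rewrite mulrC.
apply: (@is_derive1_comp _ expR (fun x => - (e * x ^+ 2))).
apply: is_derive_eq.
by rewrite /GRing.scale/=; ring.
Qed.

Lemma is_derive_cos_phase e a t b x :
  is_derive x (1 : R) (fun x => cos (phase a t b x) * gauss e x)
   ((a - 2 * t * x) * (cos (phase a t (b + pi / 2) x) * gauss e x)
    - 2 * e * x * (cos (phase a t b x) * gauss e x)).
Proof.
apply: (@trigger_derive _ _ _ (cos (phase a t b x) *: (- (2 * e * x) * gauss e x) +
  gauss e x *: (- sin (phase a t b x) * (a - 2 * t * x)))).
  apply: (@is_deriveM _ _ (fun x => cos (phase a t b x)) (gauss e)).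
    apply: (@is_derive1_comp _ cos (phase a t b)); exact: is_derive_phase.
  exact: is_derive_gauss.
by rewrite phaseDb cosDpihalf /GRing.scale/=; ring.
Qed.

Lemma continuous_cos_phase e a t b :
  continuous (fun x => cos (phase a t b x) * gauss e x).
Proof.
by move=> x; apply: differentiable_continuous; apply/derivable1_diffP;
  have [] := is_derive_cos_phase e a t b x.
Qed.

(** The derivative of [cos (phase a t b x) * gauss e x] has integral 0; differentiating the cosine
    shifts [b] by [pi / 2]. *)
Lemma osc_ibp0 e a t b : 0 < e ->
  a * osc e 0 a t (b + pi / 2) - 2 * t * osc e 1 a t (b + pi / 2)
  - 2 * e * osc e 1 a t b = 0.
Proof.
move=> e0.
have iZ k b' c : (k <= 2)%N -> mu.-integrable setT
    (EFin \o fun x => c * (x ^+ k * (cos (phase a t b' x) * gauss e x))).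
  by move=> k2; apply: integrable_realZ; exact: integrable_osc.
have iA := iZ 0%N (b + pi / 2) a isT; have iB := iZ 1%N (b + pi / 2) (2 * t) isT.
have iC := iZ 1%N b (2 * e) isT.
rewrite /osc -!RintegralZl//; [|exact: integrable_osc..].
rewrite -RintegralB// -RintegralB//; last exact: integrable_realB.
have [|||hp hm] := @cvg_gauss_nat (fun x => cos (phase a t b x) * gauss e x) e 1 => //.
  by move=> x; rewrite normrM (ger0_norm (gauss_ge0 _ _)) ler_wpM2r ?gauss_ge0 ?cos_max.
apply: Rintegral_derive_eq0 hp hm.
- move=> x; apply: (trigger_derive (is_derive_cos_phase e a t b x)).
  by rewrite expr0 !expr1; ring.
- by move=> x; apply: cvgB; [apply: cvgB|]; apply: cvgM; try exact: cvg_cst;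
    apply: cvgM; try exact: continuous_cos_phase; exact: exprn_continuous.
- by apply: integrable_realB => //; exact: integrable_realB.
Qed.

(** Here the differentiated function carries an extra factor [x], which brings in the second moments
    appearing in the [t]-derivative. *)
Lemma osc_ibp1 e a t b : 0 < e ->
  osc e 0 a t b + a * osc e 1 a t (b + pi / 2) - 2 * t * osc e 2 a t (b + pi / 2)
  - 2 * e * osc e 2 a t b = 0.
Proof.
move=> e0.
have i k b' : (k <= 2)%N -> mu.-integrable setT
    (EFin \o fun x => x ^+ k * (cos (phase a t b' x) * gauss e x)).
  by move=> k2; exact: integrable_osc.
have iZ k b' c : (k <= 2)%N -> mu.-integrable setT
    (EFin \o fun x => c * (x ^+ k * (cos (phase a t b' x) * gauss e x))).
  by move=> k2; apply: integrable_realZ; exact: i.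
have iA := iZ 1%N (b + pi / 2) a isT; have iB := iZ 2%N (b + pi / 2) (2 * t) isT.
have iC := iZ 2%N b (2 * e) isT; have i0 := i 0%N b isT.
rewrite /osc -!RintegralZl//; [|exact: integrable_osc..].
rewrite -RintegralD// -RintegralB//; last exact: integrable_realD.
rewrite -RintegralB//; last by apply: integrable_realB => //; exact: integrable_realD.
have [|||hp hm] := @cvg_gauss_nat (fun x => x ^+ 1 * (cos (phase a t b x) * gauss e x))
  (e / 2) (1 + 2 / e).
- by rewrite divr_gt0.
- by rewrite addr_ge0// divr_ge0// ltW.
- by move=> x; exact: osc_integrand_le.
apply: Rintegral_derive_eq0 hp hm.
- move=> x; apply: (@trigger_derive _ _ _ (x *:
    ((a - 2 * t * x) * (cos (phase a t (b + pi / 2) x) * gauss e x)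
    - 2 * e * x * (cos (phase a t b x) * gauss e x)) +
    (cos (phase a t b x) * gauss e x) *: 1)).
    apply: (@is_deriveM _ _ id (fun x => cos (phase a t b x) * gauss e x)).
    exact: is_derive_cos_phase.
  by rewrite expr0 expr1 expr2 /GRing.scale/=; ring.
- by move=> x; apply: cvgB; [apply: cvgB; [apply: cvgD|]|]; apply: cvgM; try exact: cvg_cst;
    try exact: continuous_cos_phase; try exact: exprn_continuous;
    apply: cvgM; try exact: continuous_cos_phase; exact: exprn_continuous.
- by apply: integrable_realB => //; apply: integrable_realB => //; exact: integrable_realD.
Qed.

End osc.

(** * Differential equations for the modulus of the kernel *)

Section osc_derive.
Context {R : realType}.
Notation mu := (@lebesgue_measure R).
Implicit Types e a t b x : R.

(** Affine dependence of the phase on [r] covers both parameters: [q x = x] for [a], [q x = - x^2]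
    for [t]. The bound on [q] yields a Gaussian majorant of the derivative, uniform in [r]. *)
Lemma is_derive_under_cos e (p q : R -> R) r : 0 < e ->
  measurable_fun [set: measurableTypeR R] p ->
  measurable_fun [set: measurableTypeR R] q ->
  (forall x, `|q x| <= 1 + x ^+ 2) ->
  is_derive r (1 : R) (fun r => \int[mu]_x (cos (p x + r * q x) * gauss e x))
    (\int[mu]_x (- sin (p x + r * q x) * q x * gauss e x)).
Proof.
move=> e0 mp mq qle.
pose f (r x : R) := cos (p x + r * q x) * gauss e x.
have fd (x r' : R) : is_derive r' (1 : R) (fun r : R => f r x) (- sin (p x + r' * q x) * q x * gauss e x).
  rewrite /f; apply: (@trigger_derive _ _ _ (gauss e x *: (- sin (p x + r' * q x) * q x))).
    under eq_fun do rewrite mulrC.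
    apply: (@is_deriveZ _ _ _ (fun r : R => cos (p x + r * q x)) (gauss e x)).
    apply: (@is_derive1_comp _ cos (fun r => p x + r * q x)).
    by apply: is_derive_eq; rewrite /GRing.scale/=; ring.
  by rewrite /GRing.scale/=; ring.
have df x r' : partial1of2 f r' x = - sin (p x + r' * q x) * q x * gauss e x.
  by rewrite partial1of2E; have [] := fd x r'.
have intf r' : mu.-integrable setT (EFin \o f r').
  apply: (@le_integrable_gauss _ _ e 1) => //.
    apply: measurable_funM; last exact: measurable_gauss.
    apply: measurableT_comp; first exact: measurable_cos.
    by apply: measurable_funD => //; exact: measurable_funM.
  move=> x; rewrite normrM (ger0_norm (gauss_ge0 _ _)) ler_wpM2r ?gauss_ge0//.
  exact: cos_max.
have rI : `](r - 1), (r + 1)[%classic r.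
  by rewrite /= in_itv/= ltrBlDr ltrDl ltr01.
have G0 y : 0 <= (1 + 2 / e) * gauss (e / 2) y.
  by rewrite mulr_ge0 ?gauss_ge0// addr_ge0// divr_ge0// ltW.
have iG : mu.-integrable setT (EFin \o (fun y => (1 + 2 / e) * gauss (e / 2) y)).
  by apply: integrable_realZ; apply: integrable_gauss; rewrite divr_gt0.
have Gub x y : `](r - 1), (r + 1)[%classic x -> [set: measurableTypeR R] y ->
    `|partial1of2 f x y| <= (1 + 2 / e) * gauss (e / 2) y.
  move=> _ _; rewrite df; apply: le_trans (sqr_gauss_le y e0).
  rewrite normrM (ger0_norm (gauss_ge0 _ _)) ler_wpM2r ?gauss_ge0// normrM.
  by rewrite -[leRHS]mul1r ler_pM// normrN sin_max.
have H1 := @derivable_under_integral R _ _ mu f setT measurableT r _ _ rI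
  (fun x _ => intf x) (fun x y _ _ => @ex_derive _ _ _ _ _ _ _ (fd y x)) _ G0 iG Gub.
have H2 := @differentiation_under_integral R _ _ mu f setT measurableT r _ _ rI
  (fun x _ => intf x) (fun x y _ _ => @ex_derive _ _ _ _ _ _ _ (fd y x)) _ G0 iG Gub.
apply: DeriveDef; first exact: H1.
rewrite -derive1E H2; apply: eq_Rintegral => x _; exact: df.
Qed.

Lemma is_derive_osc_a e a t b : 0 < e ->
  is_derive a (1 : R) (fun a => osc e 0 a t b) (osc e 1 a t (b + pi / 2)).
Proof.
move=> e0.
have H := @is_derive_under_cos e (fun x => - t * x ^+ 2 + b) id a e0.
rewrite (_ : (fun a => _) = fun r : R =>
    \int[mu]_x (cos (- t * x ^+ 2 + b + r * id x) * gauss e x)); last first.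
  apply/funext => r; apply: eq_Rintegral => x _; rewrite expr0 mul1r /phase.
  by congr (cos _ * _); ring.
apply: trigger_derive; first apply: H.
- by apply: measurable_funD => //; apply: measurable_funM => //; exact: measurable_funX.
- by [].
- move=> x; have : `|x| ^+ 2 = x ^+ 2 by rewrite real_normK ?num_real.
  have := normr_ge0 x; nra.
- apply: eq_Rintegral => x _; rewrite phaseDb cosDpihalf expr1 /phase.
  rewrite (_ : a * x - t * x ^+ 2 + b = - t * x ^+ 2 + b + a * x); ring.
Qed.

Lemma is_derive_osc_t e a t b : 0 < e ->
  is_derive t (1 : R) (fun t => osc e 0 a t b) (- osc e 2 a t (b + pi / 2)).
Proof.
move=> e0.
have H := @is_derive_under_cos e (fun x => a * x + b) (fun x => - x ^+ 2) t e0.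
rewrite (_ : (fun t => _) = fun r : R =>
    \int[mu]_x (cos (a * x + b + r * (- x ^+ 2)) * gauss e x)); last first.
  apply/funext => r; apply: eq_Rintegral => x _; rewrite expr0 mul1r /phase.
  by congr (cos _ * _); ring.
apply: trigger_derive; first apply: H.
- by apply: measurable_funD => //; exact: measurable_funM.
- by apply: measurableT_comp => //; exact: measurable_funX.
- by move=> x; rewrite normrN ger0_norm ?sqr_ge0// lerDr.
- rewrite /osc -mulN1r -RintegralZl//; last exact: integrable_osc.
  apply: eq_Rintegral => x _; rewrite phaseDb cosDpihalf /phase.
  rewrite (_ : a * x - t * x ^+ 2 + b = a * x + b + t * - x ^+ 2); ring.
Qed.

(** By the addition formula, the phase shifts [0] and [pi / 2] determine all others. *)
Lemma osc_cos e k a t b : 0 < e -> (k <= 2)%N ->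
  osc e k a t b = cos b * osc e k a t 0 + sin b * osc e k a t (pi / 2).
Proof.
move=> e0 k2; rewrite /osc -!RintegralZl//; [|exact: integrable_osc..].
rewrite -RintegralD//; [|apply: integrable_realZ; exact: integrable_osc..].
apply: eq_Rintegral => x _.
have ph c : phase a t c x = phase a t 0 x + c by rewrite -phaseDb add0r.
by rewrite (ph b) (ph (pi / 2)) cosDpihalf cosD; ring.
Qed.

(* The squared modulus of [\int exp(i (a x - t x^2) - e x^2) dx]. *)
Definition osc2 e a t := osc e 0 a t 0 ^+ 2 + osc e 0 a t (pi / 2) ^+ 2.

Lemma osc_pi e k a t : 0 < e -> (k <= 2)%N -> osc e k a t (pi / 2 + pi / 2) = - osc e k a t 0.
Proof.
move=> e0 k2; rewrite osc_cos// -splitr cospi sinpi; ring.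
Qed.

Lemma is_derive_sqr (f : R -> R) (df x : R) : is_derive x (1 : R) f df ->
  is_derive x (1 : R) (fun y : R => f y ^+ 2) (2 * f x * df).
Proof.
move=> d; apply: (trigger_derive (is_deriveM d d)).
by rewrite /GRing.scale/=; ring.
Qed.

(** The identities of [osc_ibp0] at [b = 0] and [b = pi / 2] form a linear system for the two first
    moments, of determinant proportional to [e^2 + t^2]. Solving it by Cramer's rule turns the
    derivative into a multiple of [osc2] itself. *)
Lemma is_derive_osc2_a e a t : 0 < e ->
  is_derive a (1 : R) (fun a : R => osc2 e a t)
   (- (a * e / (e ^+ 2 + t ^+ 2)) * osc2 e a t).
Proof.
move=> e0.
have d0 := is_derive_sqr (is_derive_osc_a a t 0 e0).
have d1 := is_derive_sqr (is_derive_osc_a a t (pi / 2) e0).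
apply: (trigger_derive (is_deriveD d0 d1)).
have := osc_ibp0 a t 0 e0; have := osc_ibp0 a t (pi / 2) e0.
rewrite osc_pi// osc_pi// add0r /osc2.
set X := osc e 0 a t 0; set Y := osc e 0 a t (pi / 2).
set Q := osc e 1 a t 0; set P := osc e 1 a t (pi / 2).
have r0 : e ^+ 2 + t ^+ 2 != 0 by rewrite gt_eqF// ltr_wpDr ?sqr_ge0 ?exprn_gt0.
move=> E1 E2.
have eP : 2 * P = (- a * e * X + a * t * Y) / (e ^+ 2 + t ^+ 2).
  apply: (mulIf r0); rewrite divfK//.
  suff : e * (a * - X - 2 * t * - Q - 2 * e * P) + t * (a * Y - 2 * t * P - 2 * e * Q) = 0.
    by move=> H; apply/eqP; rewrite -subr_eq0; apply/eqP; rewrite -oppr0 -H; ring.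
  by rewrite E1 E2 !mulr0 addr0.
have eQ : 2 * Q = (a * t * X + a * e * Y) / (e ^+ 2 + t ^+ 2).
  apply: (mulIf r0); rewrite divfK//.
  suff : e * (a * Y - 2 * t * P - 2 * e * Q) - t * (a * - X - 2 * t * - Q - 2 * e * P) = 0.
    by move=> H; apply/eqP; rewrite -subr_eq0; apply/eqP; rewrite -oppr0 -H; ring.
  by rewrite E1 E2 !mulr0 subr0.
have -> : 2 * X * P + 2 * Y * - Q = X * (2 * P) - Y * (2 * Q) by ring.
by rewrite eP eQ; field.
Qed.

(** At [a = 0] the first moments drop out of [osc_ibp1], so the second moments are determined by the
    zeroth ones. *)
Lemma is_derive_osc2_t e t : 0 < e ->
  is_derive t (1 : R) (fun t : R => osc2 e 0 t)
   (- (t / (e ^+ 2 + t ^+ 2)) * osc2 e 0 t).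
Proof.
move=> e0.
have d0 := is_derive_sqr (is_derive_osc_t 0 t 0 e0).
have d1 := is_derive_sqr (is_derive_osc_t 0 t (pi / 2) e0).
apply: (trigger_derive (is_deriveD d0 d1)).
have := osc_ibp1 0 t 0 e0; have := osc_ibp1 0 t (pi / 2) e0.
rewrite !mul0r osc_pi// !add0r /osc2.
set X := osc e 0 0 t 0; set Y := osc e 0 0 t (pi / 2).
set Q := osc e 2 0 t 0; set P := osc e 2 0 t (pi / 2).
have r0 : e ^+ 2 + t ^+ 2 != 0 by rewrite gt_eqF// ltr_wpDr ?sqr_ge0 ?exprn_gt0.
move=> E1 E2.
have eP : 2 * P = (t * X + e * Y) / (e ^+ 2 + t ^+ 2).
  apply: (mulIf r0); rewrite divfK//.
  suff : e * (Y + 0 - 2 * t * - Q - 2 * e * P) + t * (X + 0 - 2 * t * P - 2 * e * Q) = 0.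
    by move=> H; apply/eqP; rewrite -subr_eq0; apply/eqP; rewrite -oppr0 -H; ring.
  by rewrite E1 E2 !mulr0 addr0.
have eQ : 2 * Q = (e * X - t * Y) / (e ^+ 2 + t ^+ 2).
  apply: (mulIf r0); rewrite divfK//.
  suff : e * (X + 0 - 2 * t * P - 2 * e * Q) - t * (Y + 0 - 2 * t * - Q - 2 * e * P) = 0.
    by move=> H; apply/eqP; rewrite -subr_eq0; apply/eqP; rewrite -oppr0 -H; ring.
  by rewrite E1 E2 !mulr0 subr0.
have -> : 2 * X * - P + 2 * Y * - - Q = Y * (2 * Q) - X * (2 * P) by ring.
by rewrite eP eQ; field.
Qed.

Lemma osc2_00 e : 0 < e -> osc2 e 0 0 = pi / e.
Proof.
move=> e0.
have E b : osc e 0 0 0 b = cos b * Num.sqrt (pi / e).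
  rewrite /osc -[Num.sqrt _]/(fine (Num.sqrt (pi / e))%:E) -integral_gauss//.
  rewrite -[fine _]/(\int[mu]_x gauss e x) -RintegralZl//; last exact: integrable_gauss.
  by apply: eq_Rintegral => x _; rewrite expr0 mul1r /phase !mul0r subr0 add0r.
rewrite /osc2 !E cos0 cos_pihalf mul0r mul1r expr0n addr0 sqr_sqrtr//.
by rewrite divr_ge0 ?pi_ge0// ltW.
Qed.

(** The equation in [t] makes this product constant, and its value at [t = 0] is a plain Gaussian
    integral. Squaring avoids the root of [e^2 + t^2]. *)
Lemma osc2_0 e t : 0 < e -> osc2 e 0 t ^+ 2 * (e ^+ 2 + t ^+ 2) = pi ^+ 2.
Proof.
move=> e0; pose f t : R := osc2 e 0 t ^+ 2 * (e ^+ 2 + t ^+ 2).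
suff -> : osc2 e 0 t ^+ 2 * (e ^+ 2 + t ^+ 2) = f 0.
  by rewrite /f osc2_00// expr0n addr0 exprMn exprVn divfK// gt_eqF// exprn_gt0.
apply: (@is_derive_0_is_cst _ f) => {}t.
have d := is_derive_sqr (is_derive_osc2_t t e0).
have d2 : is_derive t (1 : R) (fun t : R => e ^+ 2 + t ^+ 2) (0 + 2 * t * 1).
  by apply: is_deriveD; exact: is_derive_sqr.
apply: (trigger_derive (is_deriveM d d2)).
have r0 : e ^+ 2 + t ^+ 2 != 0 by rewrite gt_eqF// ltr_wpDr ?sqr_ge0 ?exprn_gt0.
by rewrite /GRing.scale/=; field.
Qed.

(** The equation in [a] says that [osc2 e a t] divided by the exponential does not depend on [a]. *)
Lemma osc2E e a t : 0 < e ->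
  osc2 e a t = osc2 e 0 t * expR (- (a ^+ 2 * e / (2 * (e ^+ 2 + t ^+ 2)))).
Proof.
move=> e0; have r0 : 0 < e ^+ 2 + t ^+ 2 by rewrite ltr_wpDr ?sqr_ge0 ?exprn_gt0.
pose c := e / (2 * (e ^+ 2 + t ^+ 2)).
pose f a : R := osc2 e a t * expR (c * a ^+ 2).
suff : f a = f 0.
  rewrite /f expr0n mulr0 expR0 mulr1 => <-.
  rewrite -mulrA -expRD (_ : _ + _ = 0) ?expR0 ?mulr1//.
  by rewrite /c; field; rewrite gt_eqF.
apply: (@is_derive_0_is_cst _ f) => {}a.
have d := is_derive_osc2_a a t e0.
have d2 : is_derive a (1 : R) (fun a : R => expR (c * a ^+ 2)) (expR (c * a ^+ 2) * (c *: (2 * a * 1))).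
  apply: (@is_derive1_comp _ expR (fun a : R => c * a ^+ 2)).
  by apply: is_deriveZ; exact: is_derive_sqr.
apply: (trigger_derive (is_deriveM d d2)).
by rewrite /GRing.scale/= /c; field; rewrite gt_eqF.
Qed.

(** [osc e 0 a t b] is the component of a plane vector along [(cos b, sin b)], and [osc2] is the
    squared length of that vector. *)
Lemma osc_sqr_le e a t b : 0 < e -> osc e 0 a t b ^+ 2 <= osc2 e a t.
Proof.
move=> e0; rewrite osc_cos// /osc2.
move: (osc e 0 a t 0) (osc e 0 a t (pi / 2)) (cos2Dsin2 b) => X Y.
move: (cos b) (sin b) => c s H.
have -> : X ^+ 2 + Y ^+ 2 = (c * X + s * Y) ^+ 2 + (s * X - c * Y) ^+ 2.
  by rewrite -[LHS]mul1r -H; ring.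
by rewrite lerDl sqr_ge0.
Qed.

(** The fourth power clears the exponent [-1/4] of [e^2 + t^2], so that the comparison with shells
    needs no roots. *)
Lemma osc_pow4_le e a t b : 0 < e ->
  osc e 0 a t b ^+ 4 <=
  pi ^+ 2 / (e ^+ 2 + t ^+ 2) * expR (- (a ^+ 2 * e / (e ^+ 2 + t ^+ 2))).
Proof.
move=> e0; have r0 : 0 < e ^+ 2 + t ^+ 2 by rewrite ltr_wpDr ?sqr_ge0 ?exprn_gt0.
rewrite -(osc2_0 t e0) mulfK ?gt_eqF//.
rewrite (_ : _ * expR _ = osc2 e a t ^+ 2).
  rewrite (exprM _ 2 2) ler_sqr ?nnegrE ?sqr_ge0//; first exact: osc_sqr_le.
  by rewrite (le_trans (sqr_ge0 _) (osc_sqr_le a t 0 e0)).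
rewrite [in RHS]osc2E// exprMn; congr (_ * _); rewrite [expR _ ^+ 2]expr2 -expRD.
by congr expR; field; rewrite gt_eqF.
Qed.

End osc_derive.

(** * Gaussian majorants *)

Section dyadic.
Context {R : realType}.
Notation mu := (@lebesgue_measure R).
Implicit Types e a t b x y z : R.

Lemma exists_dyadic (m : nat) y : (1 < m)%N -> 1 <= y ->
  exists k, m%:R ^+ k <= y < m%:R ^+ k.+1.
Proof.
move=> m1 y1.
have ex : exists k, y < m%:R ^+ k.+1.
  exists (Num.truncn y).+1; apply: (lt_le_trans (truncnS_gt y)).
  by rewrite -natrX ler_nat ltnW// (ltn_trans _ (ltn_expl _ m1)).
exists (ex_minn ex); case: ex_minnP => k yk mink; rewrite yk andbT.
case: k yk mink => [|k] _ mink; first by rewrite expr0.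
by rewrite leNgt; apply/negP => /mink; rewrite ltnn.
Qed.

Lemma nneseries_geometric (c z : R) : 0 <= z < 1 ->
  (\sum_(k <oo) (c * z ^+ k)%:E)%E = (c / (1 - z))%:E.
Proof.
move=> /andP[z0 z1]; apply/cvg_lim => //.
under eq_fun do rewrite sumEFin.
apply: cvg_EFin; first exact: nearW.
by apply: cvg_geometric_series; rewrite ger0_norm.
Qed.

Lemma nneseries_ge_term (u : nat -> \bar R) k : (forall n, (0 <= u n)%E) ->
  (u k <= \sum_(n <oo) u n)%E.
Proof.
move=> u0; apply: le_trans (nneseries_lim_ge k.+1 _) => //.
by rewrite big_nat_recr//= leeDr// sume_ge0.
Qed.

(* A majorant of [rho ^ (-1/4) * exp (- e a^2 / (4 rho))], uniform in
   [0 < rho <= B ^ 4]: one Gaussian for each shell [rho ~ B ^ 4 / 16 ^ j]. *)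
Definition kappa e (B a : R) : \bar R :=
  (\sum_(j <oo) (4 * 2 ^+ j * gauss (e * 16 ^+ j / (4 * B ^+ 4)) a)%:E)%E.

(** Let [j] be the shell with [16^j <= B^4 / r < 16^(j+1)]. The upper bound and [pi^2 <= 16] limit
    the fourth power of the amplitude by [16 * 16^(j+1)], which is [(4 * 2^j)^4]; the lower bound
    gives the decay rate, divided by 4 because the Gaussian is also raised to the fourth power. *)
Lemma osc_le_kappa e B a t b : 0 < e -> 1 <= B -> e ^+ 2 + t ^+ 2 <= B ^+ 4 ->
  (`|osc e 0 a t b|%:E <= kappa e B a)%E.
Proof.
move=> e0 B1 eB; set r := e ^+ 2 + t ^+ 2 in eB.
have r0 : 0 < r by rewrite ltr_wpDr ?sqr_ge0 ?exprn_gt0.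
have B4 : 1 <= B ^+ 4 by rewrite exprn_ege1.
have [j /andP[j1 j2]] : exists j, 16%:R ^+ j <= B ^+ 4 / r < 16%:R ^+ j.+1.
  by apply: exists_dyadic => //; rewrite ler_pdivlMr// mul1r.
apply: le_trans (nneseries_ge_term j _); last first.
  by move=> n; rewrite lee_fin mulr_ge0 ?gauss_ge0.
set g := gauss _ a; rewrite lee_fin.
have g0 : 0 <= 4 * 2 ^+ j * g by rewrite mulr_ge0 ?gauss_ge0.
rewrite -(@ler_pXn2r _ 4)// ?nnegrE//.
rewrite -normrX ger0_norm; last by rewrite (exprM _ 2 2) sqr_ge0.
apply: le_trans (osc_pow4_le a t b e0) _; rewrite -/r.
have -> : (4 * 2 ^+ j * g) ^+ 4 = 16 * 16 ^+ j.+1 * g ^+ 4.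
  have j4 : (2 ^+ j) ^+ 4 = 16 ^+ j :> R.
    by rewrite -exprM mulnC exprM; congr (_ ^+ j); ring.
  by rewrite !exprMn j4 [16 ^+ j.+1]exprS; ring.
apply: ler_pM.
- by rewrite divr_ge0 ?sqr_ge0// ltW.
- exact: expR_ge0.
- rewrite -[leLHS]/(pi ^+ 2 * r^-1).
  have p4 : pi ^+ 2 <= 16 :> R.
    rewrite (_ : 16 = 4 ^+ 2); last by ring.
    rewrite ler_sqr ?nnegrE ?pi_ge0//.
    have := @pihalf_lt2 R; lra.
  apply: ler_pM => //; [exact: sqr_ge0|by rewrite invr_ge0 ltW|].
  apply: (@le_trans _ _ (B ^+ 4 / r)); last exact: ltW.
  by rewrite ler_peMl// invr_ge0 ltW.
- rewrite /g /gauss -expRM_natl ler_expR mulrN lerN2.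
  rewrite [leLHS](_ : _ = a ^+ 2 * e * (16 ^+ j / B ^+ 4)); last first.
    have := lt_le_trans ltr01 B4; move: (B ^+ 4) (16 ^+ j) => p q p0.
    by field; rewrite gt_eqF.
  rewrite -[leRHS]/(a ^+ 2 * e * r^-1) ler_wpM2l ?(mulr_ge0 (sqr_ge0 _) (ltW e0))//.
  rewrite ler_pdivrMr ?(lt_le_trans _ B4)// [leRHS]mulrC.
  exact: j1.
Qed.

Lemma kappa_ge0 e B a : (0 <= kappa e B a)%E.
Proof. by apply: nneseries_ge0 => n _ _; rewrite lee_fin mulr_ge0 ?gauss_ge0. Qed.

Lemma measurable_kappa e B : measurable_fun [set: measurableTypeR R] (kappa e B).
Proof.
apply: ge0_emeasurable_sum => [n x _ _|n _].
  by rewrite lee_fin mulr_ge0 ?gauss_ge0.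
by apply/measurable_EFinP; apply: measurable_funM => //; exact: measurable_gauss.
Qed.

(** In the term [j] the height grows like [2^j] while the width shrinks like [4^(-j)]: the integrals
    are [8 B^2 sqrt(pi / e) 2^(-j)], and their sum doubles the first. *)
Lemma integral_kappa e B m : 0 < e -> 0 < B ->
  (\int[mu]_a kappa e B (a - m))%E = (16 * B ^+ 2 * Num.sqrt (pi / e))%:E.
Proof.
move=> e0 B0; have mg c : measurable_fun [set: measurableTypeR R] (fun a => gauss c (a - m)).
  by apply: measurableT_comp; [exact: measurable_gauss|exact: measurable_funB].
rewrite integral_nneseries//; last 2 first.
- by move=> n; apply/measurable_EFinP; exact: measurable_funM.
- by move=> n x _; rewrite lee_fin mulr_ge0 ?gauss_ge0.
transitivity (\sum_(j <oo) (8 * B ^+ 2 * Num.sqrt (pi / e) * 2^-1 ^+ j)%:E)%E; last first.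
  rewrite nneseries_geometric; last by lra.
  by congr EFin; field.
apply: eq_eseriesr => j _; under eq_integral do rewrite EFinM.
have c0 : 0 < e * 16 ^+ j / (4 * B ^+ 4).
  by rewrite divr_gt0 ?mulr_gt0 ?exprn_gt0.
rewrite ge0_integralZl_EFin//; last 2 first.
- by move=> x _; rewrite lee_fin gauss_ge0.
- exact/measurable_EFinP.
rewrite integral_gauss_shift// -EFinM; congr EFin.
rewrite (_ : pi / (e * _ / _) = (2 * B ^+ 2 / 4 ^+ j) ^+ 2 * (pi / e)); last first.
  have -> : 16 ^+ j = 4 ^+ j * 4 ^+ j :> R by rewrite -exprMn; congr (_ ^+ _); ring.
  have : 0 < 4 ^+ j :> R by rewrite exprn_gt0.
  move: (4 ^+ j) => p p0.
  by field; rewrite !gt_eqF.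
rewrite sqrtrM ?sqr_ge0// sqrtr_sqr ger0_norm; last first.
  by rewrite divr_ge0// mulr_ge0// sqr_ge0.
rewrite exprVn (_ : 4 ^+ j = 2 ^+ j * 2 ^+ j :> R).
  by field; rewrite gt_eqF ?exprn_gt0.
by rewrite -exprMn; congr (_ ^+ _); ring.
Qed.

Lemma sqrt_pi_dyadic k : Num.sqrt (pi / 4^-1 ^+ k) = Num.sqrt pi * 2 ^+ k :> R.
Proof.
rewrite sqrtrM ?pi_ge0// exprVn invrK (_ : 4 ^+ k = (2 ^+ k) ^+ 2).
  by rewrite sqrtr_sqr ger0_norm.
by rewrite -exprM mulnC exprM; congr (_ ^+ _); ring.
Qed.

Definition wgt (a x : R) : R := (1 + x ^+ 2) `^ (- a).

Lemma wgt_gt0 a x : 0 < wgt a x.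
Proof. by rewrite powR_gt0// ltr_wpDr ?sqr_ge0. Qed.

Lemma measurable_wgt a : measurable_fun [set: measurableTypeR R] (wgt a).
Proof.
apply: (measurableT_comp (measurable_powR (- a))).
by apply: measurable_funD => //; exact: measurable_funX.
Qed.

Lemma wgt_term_ge0 a k x :
  0 <= expR 4 * (4 `^ (- a)) ^+ k * gauss (4^-1 ^+ k) x :> R.
Proof.
apply: mulr_ge0; last exact: gauss_ge0.
by apply: mulr_ge0; [exact: expR_ge0|apply: exprn_ge0; exact: powR_ge0].
Qed.

(** Where [4^k <= 1 + x^2 < 4^(k+1)], the weight is at most [4^(-a k)] and the Gaussian of rate
    [4^(-k)] is at least [exp(-4)]; the factor [expR 4] compensates. This single term already
    dominates. *)
Lemma wgt_le a x : 0 <= a ->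
  ((wgt a x)%:E <= \sum_(k <oo) (expR 4 * (4 `^ (- a)) ^+ k * gauss (4^-1 ^+ k) x)%:E)%E.
Proof.
move=> a0.
have [k /andP[k1 k2]] : exists k, (4%N)%:R ^+ k <= 1 + x ^+ 2 < (4%N)%:R ^+ k.+1.
  by apply: exists_dyadic => //; rewrite lerDl sqr_ge0.
apply: le_trans (nneseries_ge_term k _); last first.
  by move=> n; rewrite lee_fin wgt_term_ge0.
rewrite lee_fin mulrAC -[leLHS]mul1r; apply: ler_pM => //; first exact: powR_ge0.
  rewrite /gauss -expRD -[leLHS]expR0 ler_expR subr_ge0 exprVn mulrC ler_pdivrMr ?exprn_gt0//.
  by rewrite -exprS; apply: le_trans (ltW k2); rewrite lerDr.
rewrite -powR_mulrn ?powR_ge0// powRAC powR_mulrn//.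
rewrite /wgt !powRN lef_pV2 ?posrE ?powR_gt0 ?exprn_gt0//; last by rewrite ltr_wpDr ?sqr_ge0.
by apply: ge0_ler_powR => //; rewrite nnegrE ?exprn_ge0// addr_ge0 ?sqr_ge0.
Qed.

(** This is the threshold of the whole estimate: [4^(-a)] is the decay of the coefficients and [2]
    the growth of the integrals of the Gaussians from one scale to the next. The same ratio governs
    the mass of [wgt] and the sum of the Schur constants. *)
Lemma powR4_lt a : 2^-1 < a -> 2 * 4 `^ (- a) < 1.
Proof.
move=> a2; have r0 : 0 < a - 2^-1 by rewrite subr_gt0.
have : 1 `^ (a - 2^-1) < 4 `^ (a - 2^-1) :> R.
  by apply: gt0_ltr_powR => //; rewrite ?nnegrE//; lra.
rewrite powR1 => H.
have -> : a = 2^-1 + (a - 2^-1) by rewrite addrC subrK.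
rewrite powRN powRD; last by apply/implyP => _; rewrite gt_eqF.
rewrite powR12_sqrt// (_ : Num.sqrt 4 = 2); last first.
  by rewrite (_ : 4 = 2 ^+ 2) ?sqrtr_sqr ?ger0_norm//; ring.
by rewrite invfM mulrA divff// mul1r invf_lt1// (lt_trans ltr01 H).
Qed.

Lemma integrable_wgt a : 2^-1 < a -> mu.-integrable setT (EFin \o wgt a).
Proof.
move=> a2; apply/integrableP; split.
  by apply/measurable_EFinP; exact: measurable_wgt.
have th0 : 0 <= 4 `^ (- a) :> R by exact: powR_ge0.
apply: (@le_lt_trans _ _ (\int[mu]_x \sum_(k <oo)
    (expR 4 * (4 `^ (- a)) ^+ k * gauss (4^-1 ^+ k) x)%:E)%E).
  apply: ge0_le_integral => //.
  - apply: measurableT_comp => //.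
    by apply/measurable_EFinP; exact: measurable_wgt.
  - apply: ge0_emeasurable_sum => [k x _ _|k _].
      by rewrite lee_fin wgt_term_ge0.
    by apply/measurable_EFinP; apply: measurable_funM => //; exact: measurable_gauss.
  - move=> x _; rewrite /= ger0_norm; last exact/ltW/wgt_gt0.
    by apply: wgt_le; lra.
rewrite integral_nneseries//; last 2 first.
- by move=> k; apply/measurable_EFinP; apply: measurable_funM => //; exact: measurable_gauss.
- by move=> k x _; rewrite lee_fin wgt_term_ge0.
apply: (@le_lt_trans _ _ (\sum_(k <oo) (expR 4 * Num.sqrt pi * (2 * 4 `^ (- a)) ^+ k)%:E)%E); last first.
  by rewrite nneseries_geometric ?ltry// powR4_lt// mulr_ge0.
apply: lee_nneseries => [k _ _|k _].
  by apply: integral_ge0 => x _; rewrite lee_fin wgt_term_ge0.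
under eq_integral do rewrite EFinM.
rewrite ge0_integralZl_EFin//; last 2 first.
- by move=> x _; rewrite lee_fin gauss_ge0.
- by apply/measurable_EFinP; exact: measurable_gauss.
rewrite integral_gauss ?exprn_gt0// -EFinM lee_fin sqrt_pi_dyadic exprMn.
by rewrite le_eqVlt; apply/orP; left; apply/eqP; ring.
Qed.

End dyadic.

(** * Fubini for real-valued integrals *)

Section real_fubini.
Context d1 d2 (T1 : measurableType d1) (T2 : measurableType d2) (R : realType).
Variables (m1 : {sigma_finite_measure set T1 -> \bar R})
  (m2 : {sigma_finite_measure set T2 -> \bar R}).

(** Tonelli applies to the positive and negative parts, so measurability of [h] suffices; [fine]
    sends slice integrals that are not finite to 0. *)
Lemma measurable_Rintegral_snd (h : T1 * T2 -> R) : measurable_fun setT h ->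
  measurable_fun setT (fun x => \int[m2]_y h (x, y)).
Proof.
move=> mh; apply: measurableT_comp; first exact: fine_measurable.
have me : measurable_fun setT (EFin \o h) by exact/measurable_EFinP.
rewrite (_ : (fun x => _) = (fun x => \int[m2]_y (EFin \o h)^\+ (x, y)) \-
   (fun x => \int[m2]_y (EFin \o h)^\- (x, y)))%E.
  by apply: emeasurable_funB; apply: measurable_fun_fubini_tonelli_F => //;
    [exact: measurable_funepos|exact: measurable_funeneg].
apply/funext => x; rewrite integralE; congr (_ - _)%E; apply: eq_integral => y _.
  by rewrite !funeposE.
by rewrite !funenegE.
Qed.

Lemma measurable_Rintegral_fst (h : T1 * T2 -> R) : measurable_fun setT h ->
  measurable_fun setT (fun y => \int[m1]_x h (x, y)).
Proof.
move=> mh; apply: measurableT_comp; first exact: fine_measurable.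
have me : measurable_fun setT (EFin \o h) by exact/measurable_EFinP.
rewrite (_ : (fun x => _) = (fun y => \int[m1]_x (EFin \o h)^\+ (x, y)) \-
   (fun y => \int[m1]_x (EFin \o h)^\- (x, y)))%E.
  by apply: emeasurable_funB; apply: measurable_fun_fubini_tonelli_G => //;
    [exact: measurable_funepos|exact: measurable_funeneg].
apply/funext => x; rewrite integralE; congr (_ - _)%E; apply: eq_integral => y _.
  by rewrite !funeposE.
by rewrite !funenegE.
Qed.

Lemma integrable_prodM (a : T1 -> R) (b : T2 -> R) (c : T1 * T2 -> R) :
  m1.-integrable setT (EFin \o a) -> m2.-integrable setT (EFin \o b) ->
  measurable_fun setT c -> (forall z, `|c z| <= 1) ->
  (m1 \x m2)%E.-integrable setT (EFin \o fun z => a z.1 * b z.2 * c z).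
Proof.
move=> ia ib mc c1.
have ma : measurable_fun setT a by apply/measurable_EFinP; exact: (measurable_int m1).
have mb : measurable_fun setT b by apply/measurable_EFinP; exact: (measurable_int m2).
have mh : measurable_fun setT (fun z : T1 * T2 => a z.1 * b z.2 * c z).
  by apply: measurable_funM => //; apply: measurable_funM; exact: measurableT_comp.
apply/integrable12ltyP; first exact/measurable_EFinP.
apply: (@le_lt_trans _ _ (\int[m1]_x (`|(a x)%:E| * \int[m2]_y `|(b y)%:E|))%E).
  apply: ge0_le_integral => //.
  - by move=> x _; exact: integral_ge0.
  - apply: (@measurable_fun_fubini_tonelli_F _ _ _ _ _ m2 (abse \o (EFin \o (fun z => a z.1 * b z.2 * c z)))); last by move=> z; exact: abse_ge0.
    by apply: measurableT_comp => //; exact/measurable_EFinP.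
  - apply: (@emeasurable_funM _ _ _ setT (fun x => `|(a x)%:E|%E) (fun _ => (\int[m2]_y `|(b y)%:E|)%E)); last exact: measurable_cst.
    by apply: measurableT_comp => //; exact/measurable_EFinP.
  - move=> x _; rewrite -ge0_integralZl//; last first.
      by apply: measurableT_comp => //; exact/measurable_EFinP.
    apply: ge0_le_integral => //.
    + by apply: measurableT_comp => //; apply/measurable_EFinP; exact: (measurableT_comp mh).
    + by apply: measurable_funeM; apply: measurableT_comp => //; exact/measurable_EFinP.
    + move=> y _ /=; rewrite -EFinM lee_fin !normrM.
      by rewrite ler_piMr// mulr_ge0.
have /integrableP[_ Ib] := ib; have /integrableP[_ Ia] := ia.
have fb : (\int[m2]_y `|(b y)%:E|)%E \is a fin_num.
  by rewrite ge0_fin_numE//; exact: integral_ge0.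
rewrite -(fineK fb); set r := fine _.
rewrite ge0_integralZr//; last 2 first.
- by apply: measurableT_comp => //; exact/measurable_EFinP.
- by rewrite lee_fin fine_ge0//; exact: integral_ge0.
by rewrite muleC lte_mul_pinfty// lee_fin fine_ge0//; exact: integral_ge0.
Qed.

(** Integrability of every slice, rather than almost every one, makes the real inner integrals agree
    with the extended ones at each point. *)
Lemma Rintegral_Fubini (h : T1 * T2 -> R) :
  (m1 \x m2)%E.-integrable setT (EFin \o h) ->
  (forall x, m2.-integrable setT (EFin \o fun y => h (x, y))) ->
  (forall y, m1.-integrable setT (EFin \o fun x => h (x, y))) ->
  \int[m1]_x (\int[m2]_y h (x, y)) = \int[m2]_y (\int[m1]_x h (x, y)).
Proof.
move=> ih i2 i1; congr fine.
have E2 x : (\int[m2]_y h (x, y))%:E = (\int[m2]_y (h (x, y))%:E)%E.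
  by rewrite fineK//; exact: (integrable_fin_num measurableT (i2 x)).
have E1 y : (\int[m1]_x h (x, y))%:E = (\int[m1]_x (h (x, y))%:E)%E.
  by rewrite fineK//; exact: (integrable_fin_num measurableT (i1 y)).
under eq_integral do rewrite E2; under [RHS]eq_integral do rewrite E1.
exact: (Fubini ih).
Qed.

Lemma integrable_bddM d (T : measurableType d) (m : {measure set T -> \bar R})
  (b c : T -> R) : m.-integrable setT (EFin \o b) ->
  measurable_fun setT c -> (exists M, forall y, `|c y| <= M) ->
  m.-integrable setT (EFin \o fun y => b y * c y).
Proof.
move=> ib mc [M cM].
have mb : measurable_fun setT b by apply/measurable_EFinP; exact: (measurable_int m).
apply: (@le_integrable _ _ _ m setT measurableT _ (fun y => M%:E * (b y)%:E)%E).
- by apply/measurable_EFinP; exact: measurable_funM.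
- move=> y _; rewrite -EFinM lee_fin normrM mulrC normrM ler_wpM2r//.
  by rewrite (le_trans (cM y))// ler_norm.
- exact: integrableZl.
Qed.

(** The operator of bounded kernel [c] and its transpose are adjoint on integrable functions. This
    identity gives both the duality and the expansion of the square. *)
Lemma Rintegral_exchange (a : T1 -> R) (b : T2 -> R) (c : T1 * T2 -> R) :
  m1.-integrable setT (EFin \o a) -> m2.-integrable setT (EFin \o b) ->
  measurable_fun setT c -> (forall z, `|c z| <= 1) ->
  \int[m1]_x (a x * \int[m2]_y (b y * c (x, y))) =
  \int[m2]_y (b y * \int[m1]_x (a x * c (x, y))).
Proof.
move=> ia ib mc c1.
have i2 x : m2.-integrable setT (EFin \o fun y => b y * c (x, y)).
  by apply: integrable_bddM => //; [exact: measurableT_comp|exists 1].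
have i1 y : m1.-integrable setT (EFin \o fun x => a x * c (x, y)).
  by apply: integrable_bddM => //; [exact: measurableT_comp|exists 1].
under eq_Rintegral => x _ do rewrite -RintegralZl//.
under [RHS]eq_Rintegral => y _ do rewrite -RintegralZl//.
transitivity (\int[m1]_x \int[m2]_y (a x * b y * c (x, y))).
  by apply: eq_Rintegral => x _; apply: eq_Rintegral => y _; rewrite mulrA.
rewrite (Rintegral_Fubini (integrable_prodM ia ib mc c1)).
- by apply: eq_Rintegral => y _; apply: eq_Rintegral => x _; rewrite mulrA (mulrC (b y)).
- move=> x; have := integrableZl measurableT (a x) (i2 x).
  by apply: eq_integrable => // y _ /=; rewrite -EFinM mulrA.
- move=> y; have := integrableZl measurableT (b y) (i1 y).
  by apply: eq_integrable => // x _ /=; rewrite -EFinM mulrA [b y * _]mulrC.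
Qed.

End real_fubini.

(** * Oscillatory integrals of product form *)

Section product_osc.
Context d1 d2 (T1 : measurableType d1) (T2 : measurableType d2) (R : realType).
Variables (m1 : {sigma_finite_measure set T1 -> \bar R})
  (m2 : {sigma_finite_measure set T2 -> \bar R}).

Lemma integrable_prod (p : T1 -> R) (q : T2 -> R) :
  m1.-integrable setT (EFin \o p) -> m2.-integrable setT (EFin \o q) ->
  (m1 \x m2)%E.-integrable setT (EFin \o fun z => p z.1 * q z.2).
Proof.
move=> ip iq; have := integrable_prodM ip iq (measurable_cst (1 : R)).
move=> /(_ (fun _ => ltac:(by rewrite normr1))).
by apply: eq_integrable => // z _ /=; rewrite mulr1.
Qed.

Lemma Rintegral_prod21 (h : T1 * T2 -> R) :
  (m1 \x m2)%E.-integrable setT (EFin \o h) ->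
  (forall y, m1.-integrable setT (EFin \o fun x => h (x, y))) ->
  \int[(m1 \x m2)%E]_z h z = \int[m2]_y (\int[m1]_x h (x, y)).
Proof.
move=> ih i1; congr fine; rewrite -(integral21_prod_meas1 ih).
apply: eq_integral => y _.
by rewrite fineK//; exact: (integrable_fin_num measurableT (i1 y)).
Qed.

Lemma Rintegral_prod12 (h : T1 * T2 -> R) :
  (m1 \x m2)%E.-integrable setT (EFin \o h) ->
  (forall x, m2.-integrable setT (EFin \o fun y => h (x, y))) ->
  \int[(m1 \x m2)%E]_z h z = \int[m1]_x (\int[m2]_y h (x, y)).
Proof.
move=> ih i2; congr fine; rewrite -(integral12_prod_meas1 ih).
apply: eq_integral => x _.
by rewrite fineK//; exact: (integrable_fin_num measurableT (i2 x)).
Qed.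

(** For fixed [y] the phase [psi y] is one more phase shift, so the bound [C], uniform in [b],
    applies to the inner integral and the other factor contributes its mass. *)
Lemma prod_osc_fst (p : T1 -> R) (q : T2 -> R) (phi : T1 -> R) (psi : T2 -> R) C b :
  m1.-integrable setT (EFin \o p) -> m2.-integrable setT (EFin \o q) ->
  measurable_fun setT phi -> measurable_fun setT psi -> (forall y, 0 <= q y) ->
  (forall b, `|\int[m1]_x (p x * cos (phi x + b))| <= C) ->
  `|\int[(m1 \x m2)%E]_z (p z.1 * q z.2 * cos (phi z.1 + psi z.2 + b))|
    <= C * \int[m2]_y q y.
Proof.
move=> ip iq mphi mpsi q0 hC.
have mc : measurable_fun setT (fun z : T1 * T2 => cos (phi z.1 + psi z.2 + b)).
  apply: measurableT_comp; first exact: measurable_cos.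
  by apply: measurable_funD => //; apply: measurable_funD; exact: measurableT_comp.
have ih := integrable_prodM ip iq mc (fun z => cos_max _).
have i1 y : m1.-integrable setT (EFin \o fun x => p x * cos (phi x + (psi y + b))).
  apply: integrable_bddM => //; last by exists 1 => x; exact: cos_max.
  by apply: measurableT_comp; [exact: measurable_cos|exact: measurable_funD].
have E y : \int[m1]_x (p (x, y).1 * q (x, y).2 * cos (phi (x, y).1 + psi (x, y).2 + b)) =
    q y * \int[m1]_x (p x * cos (phi x + (psi y + b))).
  by rewrite -RintegralZl//; apply: eq_Rintegral => x _ /=; rewrite addrA mulrCA mulrA.
rewrite (Rintegral_prod21 ih); last first.
  move=> y; have := integrableZl measurableT (q y) (i1 y).
  by apply: eq_integrable => // x _ /=; rewrite -EFinM addrA mulrCA mulrA.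
under eq_Rintegral do rewrite E.
have iI : m2.-integrable setT (EFin \o fun y => q y * \int[m1]_x (p x * cos (phi x + (psi y + b)))).
  apply: integrable_bddM => //; last by exists C => y; exact: hC.
  apply: (@measurable_Rintegral_fst _ _ _ _ _ m1 (fun z => p z.1 * cos (phi z.1 + (psi z.2 + b)))).
  apply: measurable_funM.
    by apply: measurableT_comp => //; apply/measurable_EFinP; exact: (measurable_int m1).
  apply: measurableT_comp; first exact: measurable_cos.
  apply: measurable_funD; first exact: measurableT_comp.
  by apply: measurable_funD => //; exact: measurableT_comp.
apply: le_trans (le_normr_Rintegral measurableT iI) _.
rewrite -RintegralZl//; apply: le_Rintegral => //.
- exact: (integrable_norm iI).
- exact: integrable_realZ.
- by move=> y _; rewrite normrM ger0_norm// mulrC ler_wpM2r.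
Qed.

(** The mirror image, for the case where the distinguished variable is [y]. *)
Lemma prod_osc_snd (q : T1 -> R) (p : T2 -> R) (psi : T1 -> R) (phi : T2 -> R) C b :
  m1.-integrable setT (EFin \o q) -> m2.-integrable setT (EFin \o p) ->
  measurable_fun setT psi -> measurable_fun setT phi -> (forall x, 0 <= q x) ->
  (forall b, `|\int[m2]_y (p y * cos (phi y + b))| <= C) ->
  `|\int[(m1 \x m2)%E]_z (q z.1 * p z.2 * cos (psi z.1 + phi z.2 + b))|
    <= C * \int[m1]_x q x.
Proof.
move=> iq ip mpsi mphi q0 hC.
have mc : measurable_fun setT (fun z : T1 * T2 => cos (psi z.1 + phi z.2 + b)).
  apply: measurableT_comp; first exact: measurable_cos.
  by apply: measurable_funD => //; apply: measurable_funD; exact: measurableT_comp.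
have ih := integrable_prodM iq ip mc (fun z => cos_max _).
have i2 x : m2.-integrable setT (EFin \o fun y => p y * cos (phi y + (psi x + b))).
  apply: integrable_bddM => //; last by exists 1 => y; exact: cos_max.
  by apply: measurableT_comp; [exact: measurable_cos|exact: measurable_funD].
have E x : \int[m2]_y (q (x, y).1 * p (x, y).2 * cos (psi (x, y).1 + phi (x, y).2 + b)) =
    q x * \int[m2]_y (p y * cos (phi y + (psi x + b))).
  by rewrite -RintegralZl//; apply: eq_Rintegral => y _ /=; rewrite mulrA addrCA addrA.
rewrite (Rintegral_prod12 ih); last first.
  move=> x; have := integrableZl measurableT (q x) (i2 x).
  by apply: eq_integrable => // y _ /=; rewrite -EFinM mulrA addrCA addrA.
under eq_Rintegral do rewrite E.
have iI : m1.-integrable setT (EFin \o fun x => q x * \int[m2]_y (p y * cos (phi y + (psi x + b)))).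
  apply: integrable_bddM => //; last by exists C => x; exact: hC.
  apply: (@measurable_Rintegral_snd _ _ _ _ _ m2 (fun z => p z.2 * cos (phi z.2 + (psi z.1 + b)))).
  apply: measurable_funM.
    by apply: measurableT_comp => //; apply/measurable_EFinP; exact: (measurable_int m2).
  apply: measurableT_comp; first exact: measurable_cos.
  apply: measurable_funD; first exact: measurableT_comp.
  by apply: measurable_funD => //; exact: measurableT_comp.
apply: le_trans (le_normr_Rintegral measurableT iI) _.
rewrite -RintegralZl//; apply: le_Rintegral => //.
- exact: (integrable_norm iI).
- exact: integrable_realZ.
- by move=> x _; rewrite normrM ger0_norm// mulrC ler_wpM2r.
Qed.

End product_osc.

(** * Schur's test and duality *)

(** If the integral of [f] is not finite, [fine] makes the left-hand side 0, so the bound covers all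
    measurable functions. *)
Lemma le_normr_Rintegral_ereal d (T : measurableType d) (R : realType)
    (m : {measure set T -> \bar R}) (f : T -> R) : measurable_fun setT f ->
  (`|\int[m]_x f x|%:E <= \int[m]_x `|f x|%:E)%E.
Proof.
move=> mf; have mf' : measurable_fun setT (EFin \o f) by exact/measurable_EFinP.
apply: le_trans (le_abse_integral m measurableT mf').
rewrite /Rintegral; case: (\int[m]_x _)%E => [r| |] //=; by rewrite normr0 leey.
Qed.

Section schur.
Context d (T : measurableType d) (R : realType).
Variable m : {sigma_finite_measure set T -> \bar R}.

(** The inequality [2 |F x| |F y| <= F x ^ 2 + F y ^ 2] decouples the variables; Tonelli then lets
    the variable absent from [F] be integrated first against [S]. *)
Lemma schur_test (F : T -> R) (S : T * T -> \bar R) (A : \bar R) :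
  measurable_fun setT F -> measurable_fun setT S -> (forall z, (0 <= S z)%E) ->
  (0 <= A)%E ->
  (forall x, (\int[m]_y S (x, y) <= A)%E) ->
  (forall y, (\int[m]_x S (x, y) <= A)%E) ->
  (\int[m]_x \int[m]_y ((`|F x| * `|F y|)%:E * S (x, y))
    <= A * \int[m]_x (F x ^+ 2)%:E)%E.
Proof.
move=> mF mS S0 A0 S1 S2.
pose h x : R := F x ^+ 2 / 2.
have h0 x : 0 <= h x by rewrite divr_ge0 ?sqr_ge0.
have mh : measurable_fun setT h by apply: measurable_funM => //; exact: measurable_funX.
have mS1 x : measurable_fun setT (fun y => S (x, y)) by exact: measurableT_comp.
have mS2 y : measurable_fun setT (fun x => S (x, y)) by exact: measurableT_comp.
pose P (z : T * T) := ((h z.1)%:E * S z)%E.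
pose Q (z : T * T) := ((h z.2)%:E * S z)%E.
have mP : measurable_fun setT P.
  by apply: emeasurable_funM => //; apply/measurable_EFinP; exact: measurableT_comp.
have mQ : measurable_fun setT Q.
  by apply: emeasurable_funM => //; apply/measurable_EFinP; exact: measurableT_comp.
have P0 z : (0 <= P z)%E by rewrite mule_ge0 ?lee_fin.
have Q0 z : (0 <= Q z)%E by rewrite mule_ge0 ?lee_fin.
pose N (z : T * T) := ((`|F z.1| * `|F z.2|)%:E * S z)%E.
have mN : measurable_fun setT N.
  apply: emeasurable_funM => //; apply/measurable_EFinP.
  by apply: measurable_funM; apply: measurableT_comp => //; exact: measurableT_comp.
have N0 z : (0 <= N z)%E by rewrite mule_ge0 ?lee_fin ?mulr_ge0.
have bd k : measurable_fun setT k -> (forall x, (0 <= k x <= A)%E) ->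
    (\int[m]_x ((h x)%:E * k x) <= A * \int[m]_x (h x)%:E)%E.
  move=> mk kA; rewrite -ge0_integralZl//; last 2 first.
  - exact/measurable_EFinP.
  - by move=> x _; rewrite lee_fin.
  apply: ge0_le_integral => //.
  - by move=> x _; rewrite mule_ge0 ?lee_fin//; have /andP[] := kA x.
  - by apply: emeasurable_funM => //; exact/measurable_EFinP.
  - by apply: measurable_funeM; exact/measurable_EFinP.
  - by move=> x _; rewrite muleC lee_wpmul2r ?lee_fin//; have /andP[] := kA x.
have IP : (\int[m]_x \int[m]_y P (x, y) <= A * \int[m]_x (h x)%:E)%E.
  rewrite (_ : (\int[m]_x _)%E = (\int[m]_x ((h x)%:E * \int[m]_y S (x, y)))%E).
    apply: bd => [|x]; first exact: measurable_fun_fubini_tonelli_F.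
    by rewrite S1 integral_ge0.
  by apply: eq_integral => x _; rewrite -ge0_integralZl_EFin.
have IQ : (\int[m]_y \int[m]_x Q (x, y) <= A * \int[m]_x (h x)%:E)%E.
  rewrite (_ : (\int[m]_x _)%E = (\int[m]_y ((h y)%:E * \int[m]_x S (x, y)))%E).
    apply: bd => [|x]; first exact: measurable_fun_fubini_tonelli_G.
    by rewrite S2 integral_ge0.
  by apply: eq_integral => x _; rewrite -ge0_integralZl_EFin.
have IN : (\int[(m \x m)%E]_z N z <= \int[(m \x m)%E]_z P z + \int[(m \x m)%E]_z Q z)%E.
  rewrite -ge0_integralD//; apply: ge0_le_integral => //; first exact: emeasurable_funD.
  move=> z _; apply: (@le_trans _ _ ((h z.1 + h z.2)%:E * S z)%E); last first.
    by rewrite EFinD ge0_muleDl ?lee_fin.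
  rewrite lee_wpmul2r// lee_fin /h.
  rewrite -(real_normK (num_real (F z.1))) -(real_normK (num_real (F z.2))).
  by have := sqr_ge0 (`|F z.1| - `|F z.2|); rewrite sqrrB; nra.
have E1 := fubini_tonelli1 (m1 := m) (m2 := m) N mN N0.
have E2 := fubini_tonelli1 (m1 := m) (m2 := m) P mP P0.
have E3 := fubini_tonelli2 (m1 := m) (m2 := m) Q mQ Q0.
rewrite E1 E2 E3 in IN.
apply: le_trans IN _; apply: le_trans (leeD IP IQ) _.
have mhE : measurable_fun setT (EFin \o h) by exact/measurable_EFinP.
rewrite -ge0_muleDr ?integral_ge0// => [|x _|x _]; rewrite ?lee_fin//.
rewrite -ge0_integralD// => [|x _|x _]; rewrite ?lee_fin//.
rewrite lee_wpmul2l// le_eqVlt; apply/orP; left; apply/eqP; apply: eq_integral => x _.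
by rewrite -EFinD -splitr.
Qed.

End schur.

(** * The transposed operator and its quadratic form *)

Section ttstar.
Context d1 d2 (T1 : measurableType d1) (T2 : measurableType d2) (R : realType).
Variables (m1 : {sigma_finite_measure set T1 -> \bar R})
  (m2 : {sigma_finite_measure set T2 -> \bar R}).
Variable c : T1 * T2 -> R.
Hypotheses (mc : measurable_fun setT c) (c1 : forall z, `|c z| <= 1).

(** Transpose of the operator [f |-> \int f(w) c(x, w) dw], to be used for the linearized maximal
    operator. *)
Definition adjoint (F : T1 -> R) (w : T2) : R := \int[m1]_x (F x * c (x, w)).

Lemma measurable_adjoint F : measurable_fun setT F ->
  measurable_fun setT (adjoint F).
Proof.
move=> mF; apply: (@measurable_Rintegral_fst _ _ _ _ _ m1 (fun z => F z.1 * c (z.1, z.2))).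
apply: measurable_funM; first exact: measurableT_comp.
by apply: measurableT_comp => //; apply: measurable_fun_pair.
Qed.

Lemma adjoint_bounded F : m1.-integrable setT (EFin \o F) ->
  exists M, forall w, `|adjoint F w| <= M.
Proof.
move=> iF; exists (\int[m1]_x `|F x|) => w.
have i : m1.-integrable setT (EFin \o fun x => F x * c (x, w)).
  by apply: integrable_bddM => //; [exact: measurableT_comp|exists 1].
apply: le_trans (le_normr_Rintegral measurableT i) _; apply: le_Rintegral => //.
- exact: (integrable_norm i).
- exact: (integrable_norm iF).
- by move=> x _; rewrite normrM ler_piMr.
Qed.

(* Expanding the square turns the weighted norm of the adjoint into the
   quadratic form of the kernel [\int W c(x, .) c(y, .)]. *)
Lemma adjoint_schur (F : T1 -> R) (W : T2 -> R) (S : T1 * T1 -> \bar R) (A : \bar R) :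
  m1.-integrable setT (EFin \o F) -> m2.-integrable setT (EFin \o W) ->
  measurable_fun setT S -> (0 <= A)%E ->
  (forall x y, (`|\int[m2]_w (W w * c (x, w) * c (y, w))|%:E <= S (x, y))%E) ->
  (forall x, (\int[m1]_y S (x, y) <= A)%E) ->
  (forall y, (\int[m1]_x S (x, y) <= A)%E) ->
  ((\int[m2]_w (W w * adjoint F w ^+ 2))%:E <= A * \int[m1]_x (F x ^+ 2)%:E)%E.
Proof.
move=> iF iW mS A0 KS S1 S2.
have mF : measurable_fun setT F by apply/measurable_EFinP; exact: (measurable_int m1).
have mW : measurable_fun setT W by apply/measurable_EFinP; exact: (measurable_int m2).
have mG := measurable_adjoint mF.
have S0 z : (0 <= S z)%E by case: z => x y; apply: le_trans (KS x y); rewrite lee_fin.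
have iWG : m2.-integrable setT (EFin \o fun w => W w * adjoint F w).
  by apply: integrable_bddM => //; exact: adjoint_bounded.
pose K x y := \int[m2]_w (W w * c (x, w) * c (y, w)).
pose I x := \int[m2]_w (W w * adjoint F w * c (x, w)).
have E1 : \int[m2]_w (W w * adjoint F w ^+ 2) = \int[m1]_x (F x * I x).
  rewrite (Rintegral_exchange iF iWG mc c1).
  by apply: eq_Rintegral => w _; rewrite expr2 mulrA.
have E2 x : I x = \int[m1]_y (F y * K x y).
  have iWc : m2.-integrable setT (EFin \o fun w => W w * c (x, w)).
    by apply: integrable_bddM => //; [exact: measurableT_comp|exists 1].
  rewrite (Rintegral_exchange iF iWc mc c1).
  by apply: eq_Rintegral => w _; rewrite /adjoint mulrAC.
have mI : measurable_fun setT I.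
  apply: (@measurable_Rintegral_snd _ _ _ _ _ m2 (fun z => W z.2 * adjoint F z.2 * c (z.1, z.2))).
  apply: measurable_funM; last by apply: measurableT_comp => //; apply: measurable_fun_pair.
  by apply: measurable_funM; exact: measurableT_comp.
have mK x : measurable_fun setT (K x).
  apply: (@measurable_Rintegral_snd _ _ _ _ _ m2 (fun z => W z.2 * c (x, z.2) * c (z.1, z.2))).
  apply: measurable_funM; last by apply: measurableT_comp => //; apply: measurable_fun_pair.
  apply: measurable_funM; first exact: measurableT_comp.
  by apply: (measurableT_comp mc); apply: measurable_fun_pair.
rewrite E1.
apply: le_trans; last exact: (schur_test (m := m1) (F := F) (S := S)).
apply: (@le_trans _ _ (`|\int[m1]_x (F x * I x)|%:E)); first by rewrite lee_fin ler_norm.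
apply: le_trans (le_normr_Rintegral_ereal _ _) _; first exact: measurable_funM.
have mN : measurable_fun setT (fun z : T1 * T1 => (`|F z.1| * `|F z.2|)%:E * S z)%E.
  apply: emeasurable_funM => //; apply/measurable_EFinP.
  by apply: measurable_funM; apply: measurableT_comp => //; exact: measurableT_comp.
have N0 z : (0 <= (`|F z.1| * `|F z.2|)%:E * S z)%E by rewrite mule_ge0 ?lee_fin ?mulr_ge0.
apply: ge0_le_integral => //.
- by apply/measurable_EFinP; apply: measurableT_comp => //; exact: measurable_funM.
- exact: (@measurable_fun_fubini_tonelli_F _ _ _ _ _ m1 _ mN).
move=> x _; rewrite normrM EFinM.
apply: (@le_trans _ _ (`|F x|%:E * \int[m1]_y (`|F y|%:E * S (x, y)))%E).
  apply: lee_wpmul2l; first by rewrite lee_fin.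
  rewrite E2; apply: le_trans (le_normr_Rintegral_ereal _ _) _; first exact: measurable_funM.
  apply: ge0_le_integral => //.
  - by apply/measurable_EFinP; apply: measurableT_comp => //; exact: measurable_funM.
  - apply: emeasurable_funM; last exact: measurableT_comp.
    by apply/measurable_EFinP; exact: measurableT_comp.
  - by move=> y _; rewrite normrM EFinM lee_wpmul2l// ?lee_fin//; exact: KS.
rewrite -ge0_integralZl_EFin//.
- by under eq_integral do rewrite muleA -EFinM.
- by move=> y _; rewrite mule_ge0 ?lee_fin.
- apply: emeasurable_funM; last exact: measurableT_comp.
  by apply/measurable_EFinP; exact: measurableT_comp.
Qed.

End ttstar.

(** * From kernel bounds to an operator bound *)

Section ttstar_bound.
Context d1 d2 (T1 : measurableType d1) (T2 : measurableType d2) (R : realType).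
Variables (m1 : {sigma_finite_measure set T1 -> \bar R})
  (m2 : {sigma_finite_measure set T2 -> \bar R}).
Variable c : T1 * T2 -> R.
Hypotheses (mc : measurable_fun setT c) (c1 : forall z, `|c z| <= 1).
(** [W0] is the weight of interest, the [W k] are the terms of its majorant; [S k] bounds the kernel
    belonging to [W k], with Schur constant [a k]. *)
Variables (W0 : T2 -> R) (W : nat -> T2 -> R) (S : nat -> T1 * T1 -> \bar R)
  (a : nat -> R) (A : R).
Hypotheses (W0_gt0 : forall w, 0 < W0 w) (mW0 : measurable_fun setT W0)
  (mW0V : measurable_fun setT (fun w => (W0 w)^-1))
  (W_ge0 : forall k w, 0 <= W k w)
  (iW : forall k, m2.-integrable setT (EFin \o W k))
  (W0_le : forall w, ((W0 w)%:E <= \sum_(k <oo) (W k w)%:E)%E)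
  (mS : forall k, measurable_fun setT (S k)) (a_ge0 : forall k, 0 <= a k)
  (KS : forall k x y,
    (`|\int[m2]_w (W k w * c (x, w) * c (y, w))|%:E <= S k (x, y))%E)
  (S1 : forall k x, (\int[m1]_y S k (x, y) <= (a k)%:E)%E)
  (S2 : forall k y, (\int[m1]_x S k (x, y) <= (a k)%:E)%E)
  (A_gt0 : 0 < A) (a_le : (\sum_(k <oo) (a k)%:E <= A%:E)%E).

(** The square of the adjoint is nonnegative, so [W0] can be replaced by the series of the [W k];
    each term then falls under [adjoint_schur]. *)
Lemma adjoint_weighted_le (F : T1 -> R) : m1.-integrable setT (EFin \o F) ->
  m1.-integrable setT (EFin \o fun x => F x ^+ 2) ->
  (\int[m2]_w (W0 w * adjoint m1 c F w ^+ 2)%:E <= A%:E * \int[m1]_x (F x ^+ 2)%:E)%E.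
Proof.
move=> iF iF2; set G := adjoint m1 c F.
have mF : measurable_fun setT F by apply/measurable_EFinP; exact: (measurable_int m1).
have mG : measurable_fun setT G by exact: measurable_adjoint.
have mG2 : measurable_fun setT (fun w => G w ^+ 2) by exact: measurable_funX.
have mW k : measurable_fun setT (W k) by apply/measurable_EFinP; exact: (measurable_int m2).
have [M GM] := adjoint_bounded mc c1 iF.
have iWG k : m2.-integrable setT (EFin \o fun w => W k w * G w ^+ 2).
  apply: integrable_bddM => //; exists (M ^+ 2) => w.
  by rewrite normrX ler_pXn2r// ?nnegrE// (le_trans _ (GM w)).
have fI : (\int[m1]_x (F x ^+ 2)%:E)%E \is a fin_num by exact: (integrable_fin_num measurableT iF2).
have I0 : (0 <= \int[m1]_x (F x ^+ 2)%:E)%E by apply: integral_ge0 => x _; rewrite lee_fin sqr_ge0.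
apply: (@le_trans _ _ (\int[m2]_w \sum_(k <oo) (W k w * G w ^+ 2)%:E)%E).
  apply: ge0_le_integral => //.
  - by move=> w _; rewrite lee_fin mulr_ge0 ?sqr_ge0// ltW.
  - by apply/measurable_EFinP; exact: measurable_funM.
  - apply: ge0_emeasurable_sum => [k w _ _|k _]; first by rewrite lee_fin mulr_ge0 ?sqr_ge0.
    by apply/measurable_EFinP; exact: measurable_funM.
  - move=> w _; rewrite mulrC EFinM.
    under eq_eseriesr do rewrite mulrC EFinM.
    rewrite nneseriesZl; last by move=> k _; rewrite lee_fin.
    by rewrite lee_wpmul2l// lee_fin sqr_ge0.
rewrite integral_nneseries//; last 2 first.
- by move=> k; apply/measurable_EFinP; exact: measurable_funM.
- by move=> k w _; rewrite lee_fin mulr_ge0 ?sqr_ge0.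
apply: (@le_trans _ _ (\sum_(k <oo) ((\int[m1]_x (F x ^+ 2)%:E) * (a k)%:E))%E).
  apply: lee_nneseries => [k _ _|k _].
    by apply: integral_ge0 => w _; rewrite lee_fin mulr_ge0 ?sqr_ge0.
  rewrite muleC; apply: le_trans (adjoint_schur mc c1 iF (iW k) (mS k) _ (KS k) (S1 k) (S2 k)).
    rewrite /Rintegral fineK//; exact: (integrable_fin_num measurableT (iWG k)).
  by rewrite lee_fin.
rewrite -(fineK fI) nneseriesZl; last by move=> k _; rewrite lee_fin.
by rewrite muleC lee_wpmul2r// fineK.
Qed.

(** With [U] the image of [f], the test function is [U] itself cut to [D n]: then
    [\int F^2 = \int f G] with [G] the adjoint image of [F]. Young's inequality gives back half of
    [\int F^2], which is finite and can be absorbed; [n] then tends to infinity by monotone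
    convergence. *)
Lemma ttstar_bound (D : nat -> set T1) (f : T2 -> R) :
  (forall n, measurable (D n)) -> nondecreasing_seq D -> \bigcup_n D n = setT ->
  (forall n, (m1 (D n) < +oo)%E) ->
  m2.-integrable setT (EFin \o f) ->
  (\int[m1]_x ((\int[m2]_w (f w * c (x, w))) ^+ 2)%:E
    <= A%:E * \int[m2]_w (f w ^+ 2 / W0 w)%:E)%E.
Proof.
move=> mD ndD DT finD jf.
have mf : measurable_fun setT f by apply/measurable_EFinP; exact: (measurable_int m2).
pose U x := \int[m2]_w (f w * c (x, w)).
have mU : measurable_fun setT U.
  apply: (@measurable_Rintegral_snd _ _ _ _ _ m2 (fun z => f z.2 * c (z.1, z.2))).
  apply: measurable_funM; first exact: measurableT_comp.
  by apply: measurableT_comp => //; apply: measurable_fun_pair.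
have UM x : `|U x| <= \int[m2]_w `|f w|.
  have i : m2.-integrable setT (EFin \o fun w => f w * c (x, w)).
    by apply: integrable_bddM => //; [exact: measurableT_comp|exists 1].
  apply: le_trans (le_normr_Rintegral measurableT i) _; apply: le_Rintegral => //.
  - exact: (integrable_norm i).
  - exact: (integrable_norm jf).
  - by move=> w _; rewrite normrM ler_piMr.
set Q := (\int[m2]_w _)%E.
have Q0 : (0 <= Q)%E.
  by apply: integral_ge0 => w _; rewrite lee_fin divr_ge0 ?sqr_ge0// ltW.
have [Qfin|] := boolP (Q \is a fin_num); last first.
  rewrite ge0_fin_numE// -leNgt leye_eq => /eqP ->.
  by rewrite gt0_muley ?leey// lte_fin.
have main n : (\int[m1]_(x in D n) (U x ^+ 2)%:E <= A%:E * Q)%E.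
  (* [U] is bounded and [D n] has finite measure, so [F] and [F ^+ 2] are integrable. *)
  pose F x := \1_(D n) x * U x.
  have iD : m1.-integrable setT (EFin \o (\1_(D n) : T1 -> R)).
    apply/integrableP; split; first exact/measurable_EFinP.
    rewrite (eq_integral (fun x => (\1_(D n) x)%:E)) => [|x _].
      by rewrite integral_indic// setIT; exact: finD.
    by rewrite gee0_abs// lee_fin.
  have iF : m1.-integrable setT (EFin \o F).
    by apply: integrable_bddM => //; exists (\int[m2]_w `|f w|).
  have F2 x : F x ^+ 2 = \1_(D n) x * U x ^+ 2.
    by rewrite /F exprMn indicE; case: (x \in D n); rewrite ?expr1n// expr0n.
  have iF2 : m1.-integrable setT (EFin \o fun x => F x ^+ 2).
    rewrite (_ : _ \o _ = EFin \o (fun x => \1_(D n) x * U x ^+ 2)).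
      apply: integrable_bddM => //; first exact: measurable_funX.
      exists ((\int[m2]_w `|f w|) ^+ 2) => x.
      by rewrite normrX ler_pXn2r// ?nnegrE// (le_trans _ (UM x)).
    by apply/funext => x; rewrite /= F2.
  have -> : (\int[m1]_(x in D n) (U x ^+ 2)%:E = \int[m1]_x (F x ^+ 2)%:E)%E.
    rewrite integral_mkcond; apply: eq_integral => x _.
    by rewrite patchE F2 indicE; case: (x \in D n); rewrite ?mul1r ?mul0r.
  have fI : (\int[m1]_x (F x ^+ 2)%:E)%E \is a fin_num by exact: (integrable_fin_num measurableT iF2).
  have H := adjoint_weighted_le iF iF2.
  set G := adjoint m1 c F in H.
  have mG : measurable_fun setT G.
    by apply: measurable_adjoint => //; apply/measurable_EFinP; exact: (measurable_int m1).
  have mW0G : measurable_fun setT (fun w => (W0 w * G w ^+ 2)%:E).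
    by apply/measurable_EFinP; apply: measurable_funM => //; exact: measurable_funX.
  have mfW : measurable_fun setT (fun w => (f w ^+ 2 / W0 w)%:E).
    apply/measurable_EFinP; apply: measurable_funM => //; exact: measurable_funX.
  have EI : \int[m1]_x (F x ^+ 2) = \int[m2]_w (f w * G w).
    rewrite -(Rintegral_exchange iF jf mc c1).
    apply: eq_Rintegral => x _; rewrite F2 /F expr2 mulrA -/(U x).
    by rewrite indicE; case: (x \in D n); rewrite ?mul1r ?mul0r.
  (* Pointwise Young inequality with ratio [A / W0 w]: the factor [1 / (2 A)] meets the constant [A]
     of [adjoint_weighted_le] and leaves one half. *)
  have B1 : ((\int[m1]_x (F x ^+ 2))%:E <=
      (A / 2)%:E * Q + (2 * A)^-1%:E * \int[m2]_w (W0 w * G w ^+ 2)%:E)%E.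
    rewrite EI; apply: (@le_trans _ _ (`|\int[m2]_w (f w * G w)|%:E)); first by rewrite lee_fin ler_norm.
    apply: le_trans (le_normr_Rintegral_ereal _ _) _; first exact: measurable_funM.
    have A2 : 0 <= A / 2 by rewrite divr_ge0// ltW.
    have A2V : 0 <= (2 * A)^-1 by rewrite invr_ge0 mulr_ge0// ltW.
    rewrite -ge0_integralZl_EFin// => [|w _]; last by rewrite lee_fin divr_ge0 ?sqr_ge0// ltW.
    rewrite -ge0_integralZl_EFin// => [|w _]; last by rewrite lee_fin mulr_ge0 ?sqr_ge0// ltW.
    rewrite -ge0_integralD//; last 4 first.
    - by move=> w _; rewrite mule_ge0// lee_fin divr_ge0 ?sqr_ge0// ltW.
    - exact: measurable_funeM.
    - by move=> w _; rewrite mule_ge0// lee_fin mulr_ge0 ?sqr_ge0// ltW.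
    - exact: measurable_funeM.
    apply: ge0_le_integral => //.
    - by apply/measurable_EFinP; apply: measurableT_comp => //; exact: measurable_funM.
    - by apply: emeasurable_funD; exact: measurable_funeM.
    move=> w _; rewrite -!EFinM -EFinD lee_fin normrM.
    have w0 := W0_gt0 w.
    have r0 : 0 < A / W0 w by rewrite divr_gt0.
    rewrite -(real_normK (num_real (f w))) -(real_normK (num_real (G w))).
    move: (`|f w|) (`|G w|) => u v; set r := A / W0 w in r0 *.
    have -> : A / 2 * (u ^+ 2 / W0 w) + (2 * A)^-1 * (W0 w * v ^+ 2) =
        (r * u ^+ 2 + v ^+ 2 / r) / 2.
      by rewrite /r; field; rewrite !gt_eqF.
    rewrite -subr_ge0 (_ : _ - _ = (r * u - v) ^+ 2 / (2 * r)).
      by rewrite divr_ge0 ?sqr_ge0// mulr_ge0// ltW.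
    by field; rewrite gt_eqF.
  have B2 : ((\int[m1]_x (F x ^+ 2))%:E <=
      (A / 2)%:E * Q + (2 * A)^-1%:E * (A%:E * (\int[m1]_x (F x ^+ 2))%:E))%E.
    apply: le_trans B1 _; rewrite leeD2l// lee_wpmul2l//.
      by rewrite lee_fin invr_ge0 mulr_ge0// ltW.
    by rewrite fineK.
  rewrite -(fineK fI) -(fineK Qfin) -EFinM lee_fin.
  move: B2; rewrite -(fineK Qfin) -!EFinM -EFinD lee_fin.
  rewrite -/(\int[m1]_x (F x ^+ 2)).
  move: (\int[m1]_x (F x ^+ 2)) (fine Q) => i q.
  have -> : (2 * A)^-1 * (A * i) = i / 2 by field; rewrite gt_eqF.
  by rewrite /=; lra.
have mU2 : measurable_fun setT (fun x => (U x ^+ 2)%:E).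
  by apply/measurable_EFinP; exact: measurable_funX.
have L := @ge0_nondecreasing_set_cvg_integral _ _ _ D (fun x => (U x ^+ 2)%:E) m1 ndD mD
  (fun n => measurable_funTS mU2) (fun n x _ => ltac:(by rewrite lee_fin sqr_ge0)).
rewrite DT in L; rewrite [leLHS](_ : _ = limn (fun n => \int[m1]_(x in D n) (U x ^+ 2)%:E)%E).
  by apply: lime_le; [apply/cvg_ex; eexists; exact: L|exact: nearW].
by apply/esym/cvg_lim.
Qed.

End ttstar_bound.

(** * The linearized maximal operator *)

Section sigma_finite_product.
Context d1 d2 (T1 : measurableType d1) (T2 : measurableType d2) (R : realType).
Variables (m1 : {sigma_finite_measure set T1 -> \bar R})
  (m2 : {sigma_finite_measure set T2 -> \bar R}).

(* The canonical sigma-finite structure of a product measure is only inferred for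
   subprobabilities; this alias recovers it, with the proof of the library. *)
Definition sfprod : set (T1 * T2) -> \bar R := (m1 \x m2)%E.

HB.instance Definition _ := Measure.on sfprod.

HB.instance Definition _ := Measure_isSigmaFinite.Build _ _ _ sfprod
  (isSigmaFinite.sigma_finiteT (lebesgue_integral_fubini.measure_function_Measure_isSigmaFinite__to__measure_function_isSigmaFinite m1 m2)).

End sigma_finite_product.

Section linearized.
Context {R : realType}.
Notation mu := (@lebesgue_measure R).
Implicit Types (p xi : R3 R) (t b e a : R) (dir : bool).

Definition symbol xi : R := xi.1.1 ^+ 2 + xi.1.2 ^+ 2 + xi.2.

Definition phase3 p t b xi : R := dot3 p xi - t * symbol xi + b.

(* [true] selects the x-coordinate, [false] the y-coordinate. *)
Definition coord dir xi : R := if dir then xi.1.1 else xi.1.2.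

(** Only the factor along [coord dir] becomes a Gaussian; the two others keep the weight, since only
    their mass is used. *)
Definition gwgt dir a e xi : R :=
  gauss e (coord dir xi) * wgt a (coord (~~ dir) xi) * wgt a xi.2.

Definition wgt3 a xi : R := wgt a xi.1.1 * wgt a xi.1.2 * wgt a xi.2.

(* Only an upper bound of the mass matters; the summand [1] makes it positive. *)
Definition wgt_mass a : R := 1 + \int[mu]_x wgt a x.

Lemma wgt_mass_gt0 a : 0 < wgt_mass a.
Proof. by rewrite ltr_pwDl// Rintegral_ge0// => x _; exact/ltW/wgt_gt0. Qed.

Lemma measurable_pr11 : measurable_fun [set: R3 R] (fun xi => xi.1.1).
Proof. by apply: measurableT_comp => //; exact: measurable_fst. Qed.

Lemma measurable_pr12 : measurable_fun [set: R3 R] (fun xi => xi.1.2).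
Proof. by apply: measurableT_comp => //; exact: measurable_fst. Qed.

Lemma measurable_symbol : measurable_fun [set: R3 R] symbol.
Proof.
apply: measurable_funD => //; apply: measurable_funD; apply: measurable_funX.
  exact: measurable_pr11.
exact: measurable_pr12.
Qed.

Lemma measurable_phase3 p t b : measurable_fun [set: R3 R] (phase3 p t b).
Proof.
apply: measurable_funD => //; apply: measurable_funB; last first.
  by apply: measurable_funM => //; exact: measurable_symbol.
apply: measurable_funD; [apply: measurable_funD|]; apply: measurable_funM => //.
  exact: measurable_pr11.
exact: measurable_pr12.
Qed.

Lemma wgt3_gt0 a xi : 0 < wgt3 a xi.
Proof. by rewrite !mulr_gt0 ?wgt_gt0. Qed.

Lemma measurable_wgt3 a : measurable_fun [set: R3 R] (wgt3 a).
Proof.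
apply: measurable_funM; [apply: measurable_funM|]; apply: measurableT_comp; try exact: measurable_wgt.
- exact: measurable_pr11.
- exact: measurable_pr12.
- by [].
Qed.

Lemma wgt3V a xi : (wgt3 a xi)^-1 = wgt3 (- a) xi.
Proof. by rewrite /wgt3 !invfM /wgt !powRN !invrK. Qed.

Lemma gwgt_ge0 dir a e xi : 0 <= gwgt dir a e xi.
Proof. by rewrite !mulr_ge0 ?gauss_ge0// ltW ?wgt_gt0. Qed.

Lemma integrable_wgt3 a : 2^-1 < a -> (leb3 R).-integrable setT (EFin \o wgt3 a).
Proof.
move=> a2; have iw := integrable_wgt a2.
exact: (integrable_prod (m1 := sfprod mu mu) (integrable_prod iw iw) iw).
Qed.

Lemma integrable_gwgt dir a e : 2^-1 < a -> 0 < e ->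
  (leb3 R).-integrable setT (EFin \o gwgt dir a e).
Proof.
move=> a2 e0; have iw := integrable_wgt a2; have ig := integrable_gauss e0.
case: dir; first exact: (integrable_prod (m1 := sfprod mu mu) (integrable_prod ig iw) iw).
have := integrable_prod (m1 := sfprod mu mu) (integrable_prod iw ig) iw.
by apply: eq_integrable => // xi _; rewrite /= /gwgt/= [gauss _ _ * _]mulrC.
Qed.

(** The phase is a sum over the three coordinates. The two that are not selected are integrated out,
    their phases going into the shift [b'], and each costs a factor [wgt_mass a]. *)
Lemma osc_kernel_le dir a e p t b C : 2^-1 < a -> 0 < e ->
  (forall b', `|osc e 0 (coord dir p) t b'| <= C) ->
  `|\int[leb3 R]_xi (gwgt dir a e xi * cos (phase3 p t b xi))| <= C * wgt_mass a ^+ 2.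
Proof.
move=> a2 e0 hC; have iw := integrable_wgt a2; have ig := integrable_gauss e0.
have w0 x : 0 <= wgt a x by exact/ltW/wgt_gt0.
have hC' q b' : q = coord dir p -> `|\int[mu]_x (gauss e x * cos (phase q t 0 x + b'))| <= C.
  move=> ->; apply: le_trans (hC b'); rewrite le_eqVlt; apply/orP; left; apply/eqP.
  congr `|_|; apply: eq_Rintegral => x _.
  by rewrite expr0 mul1r mulrC -phaseDb add0r.
have mp q : measurable_fun [set: measurableTypeR R] (phase q t 0) by exact: measurable_phase.
have mp3 : measurable_fun [set: measurableTypeR R] (fun x => p.2 * x - t * x).
  by apply: measurable_funB; exact: measurable_funM.
have C0 : 0 <= C := le_trans (normr_ge0 _) (hC 0).
have Iw : \int[mu]_x wgt a x <= wgt_mass a by rewrite lerDr.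
have I0 : 0 <= \int[mu]_x wgt a x by apply: Rintegral_ge0 => x _; exact: w0.
apply: (@le_trans _ _ (C * (\int[mu]_x wgt a x) ^+ 2)); last first.
  by rewrite ler_wpM2l// ler_pXn2r// nnegrE// (le_trans I0).
rewrite expr2 mulrA.
case: dir hC hC' => hC hC'.
- rewrite (_ : \int[leb3 R]_xi _ = \int[leb3 R]_xi (gauss e xi.1.1 * wgt a xi.1.2 * wgt a xi.2 *
     cos (phase p.1.1 t 0 xi.1.1 + phase p.1.2 t 0 xi.1.2 + (p.2 * xi.2 - t * xi.2) + b))); last first.
    apply: eq_Rintegral => xi _; congr (_ * cos _).
    by rewrite /phase3 /phase /dot3 /symbol; ring.
  apply: (@prod_osc_fst _ _ _ _ _ (sfprod mu mu) mu (fun z => gauss e z.1 * wgt a z.2) (wgt a)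
    (fun z => phase p.1.1 t 0 z.1 + phase p.1.2 t 0 z.2) (fun x => p.2 * x - t * x)) => //.
  + exact: integrable_prod.
  + by apply: measurable_funD; exact: measurableT_comp.
  + by move=> b'; apply: prod_osc_fst => // b''; exact: hC'.
- rewrite (_ : \int[leb3 R]_xi _ = \int[leb3 R]_xi (wgt a xi.1.1 * gauss e xi.1.2 * wgt a xi.2 *
     cos (phase p.1.1 t 0 xi.1.1 + phase p.1.2 t 0 xi.1.2 + (p.2 * xi.2 - t * xi.2) + b))); last first.
    apply: eq_Rintegral => xi _; rewrite /gwgt/= (mulrC (gauss _ _)); congr (_ * cos _).
    by rewrite /phase3 /phase /dot3 /symbol; ring.
  apply: (@prod_osc_fst _ _ _ _ _ (sfprod mu mu) mu (fun z => wgt a z.1 * gauss e z.2) (wgt a)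
    (fun z => phase p.1.1 t 0 z.1 + phase p.1.2 t 0 z.2) (fun x => p.2 * x - t * x)) => //.
  + exact: integrable_prod.
  + by apply: measurable_funD; exact: measurableT_comp.
  + by move=> b'; apply: prod_osc_snd => // b''; exact: hC'.
Qed.

Lemma kernel_le_kappa dir a e p t b B : 2^-1 < a -> 0 < e -> 1 <= B ->
  e ^+ 2 + t ^+ 2 <= B ^+ 4 ->
  (`|\int[leb3 R]_xi (gwgt dir a e xi * cos (phase3 p t b xi))|%:E <=
    (wgt_mass a ^+ 2)%:E * kappa e B (coord dir p))%E.
Proof.
move=> a2 e0 B1 etB.
have H b' := osc_le_kappa (coord dir p) b' e0 B1 etB.
have m0 : 0 < wgt_mass a ^+ 2 by rewrite exprn_gt0// wgt_mass_gt0.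
(* [kappa] is infinite at the origin, where the series is that of [4 * 2^j]; the bound is then
   trivial. *)
case: (kappa e B (coord dir p)) H => [r| |] H.
- by rewrite -EFinM lee_fin mulrC; apply: osc_kernel_le.
- by rewrite gt0_muley ?leey// lte_fin.
- by have := H 0; rewrite leeNy_eq.
Qed.

Lemma kappaN e B x : kappa e B (- x) = kappa e B x.
Proof. by apply: eq_eseriesr => j _; rewrite /gauss sqrrN. Qed.

(** Sum of the geometric series of Schur constants: [expR 4] comes from [wgt_le], [16] from
    [integral_kappa], [1 + 2 * T] is the parameter [B] of [kappa]. The final [1] makes the constant
    positive. *)
Definition schur_const a T : R :=
  expR 4 * wgt_mass a ^+ 2 * 16 * (1 + 2 * T) ^+ 2 * Num.sqrt pi / (1 - 2 * 4 `^ (- a)) + 1.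

Lemma schur_const_gt0 a T : 2^-1 < a -> 0 < schur_const a T.
Proof.
move=> a2; have h : 0 <= 1 - 2 * 4 `^ (- a) :> R by rewrite subr_ge0 ltW// powR4_lt.
rewrite ltr_wpDl//; apply: divr_ge0 => //.
rewrite mulr_ge0 ?sqrtr_ge0//; apply: mulr_ge0; last exact: sqr_ge0.
by rewrite mulr_ge0//; apply: mulr_ge0; [exact: expR_ge0|exact: sqr_ge0].
Qed.

(** The kernel bound sees [pos] only through [coord dir (pos x) = x] and [tau] only through its
    range, so the constant is the same for all measurable choices. *)
Lemma linearized_maximal dir a T b (pos : R -> R3 R) (tau : R -> R) (f : R3 R -> R) :
  2^-1 < a -> 0 <= T ->
  measurable_fun [set: measurableTypeR R] pos ->
  measurable_fun [set: measurableTypeR R] tau ->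
  (forall x, coord dir (pos x) = x) -> (forall x, 0 <= tau x <= T) ->
  (leb3 R).-integrable setT (EFin \o f) ->
  (\int[mu]_x ((\int[leb3 R]_xi (f xi * cos (phase3 (pos x) (tau x) b xi))) ^+ 2)%:E
    <= (schur_const a T)%:E * \int[leb3 R]_xi (f xi ^+ 2 / wgt3 a xi)%:E)%E.
Proof.
move=> a2 T0 mpos mtau cpos tauT jf.
(* Combined times have modulus at most [2 * T] and [e k <= 1], so
   [e^2 + t^2 <= 1 + (2 T)^2 <= B^2 <= B^4]. *)
pose B := 1 + 2 * T; pose e k : R := 4^-1 ^+ k.
pose ck k : R := expR 4 * (4 `^ (- a)) ^+ k.
pose c (z : measurableTypeR R * R3 R) := cos (phase3 (pos z.1) (tau z.1) b z.2).
have e0 k : 0 < e k by rewrite exprn_gt0.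
have e1 k : e k <= 1 by rewrite exprn_ile1//; lra.
have ck0 k : 0 <= ck k by rewrite mulr_ge0 ?expR_ge0// exprn_ge0// powR_ge0.
have B1 : 1 <= B by rewrite /B lerDl mulr_ge0.
have etB k t : `|t| <= 2 * T -> e k ^+ 2 + t ^+ 2 <= B ^+ 4.
  move=> tT; have : t ^+ 2 <= (2 * T) ^+ 2.
    by rewrite -(real_normK (num_real t)) ler_pXn2r// nnegrE mulr_ge0.
  have : e k ^+ 2 <= 1 by rewrite exprn_ile1// ltW.
  have : B ^+ 2 <= B ^+ 4 by rewrite ler_weXn2l.
  have : 1 + (2 * T) ^+ 2 <= B ^+ 2 by rewrite /B; nra.
  lra.
have mc : measurable_fun setT c.
  apply: measurableT_comp; first exact: measurable_cos.
  have mp : measurable_fun setT (fun z : measurableTypeR R * R3 R => pos z.1).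
    exact: measurableT_comp.
  apply: measurable_funD => //; apply: measurable_funB.
    apply: measurable_funD; [apply: measurable_funD|]; apply: measurable_funM.
    - by apply: (measurableT_comp measurable_pr11).
    - by apply: (measurableT_comp measurable_pr11).
    - by apply: (measurableT_comp measurable_pr12).
    - by apply: (measurableT_comp measurable_pr12).
    - by apply: (measurableT_comp measurable_snd).
    - by apply: (measurableT_comp measurable_snd).
  apply: measurable_funM; first exact: measurableT_comp.
  exact: (measurableT_comp measurable_symbol).
(* The product of two cosines is half the sum of the cosines of the difference and of the sum of the
   phases, hence the two terms and the factor 1/2. *)
pose S k (z : measurableTypeR R * measurableTypeR R) :=
  ((ck k * wgt_mass a ^+ 2 / 2)%:E * (kappa (e k) B (z.1 - z.2) + kappa (e k) B (z.1 + z.2)))%E.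
pose ak k := ck k * wgt_mass a ^+ 2 * (16 * B ^+ 2 * Num.sqrt (pi / e k)).
have cm0 k : 0 <= ck k * wgt_mass a ^+ 2 / 2 by rewrite divr_ge0// mulr_ge0// sqr_ge0.
have mkap k (h : measurableTypeR R * measurableTypeR R -> R) : measurable_fun setT h ->
    measurable_fun setT (fun z => kappa (e k) B (h z)).
  by move=> mh; apply: measurableT_comp; [exact: measurable_kappa|].
have mkap1 k m : measurable_fun [set: measurableTypeR R] (fun y => kappa (e k) B (y - m)).
  by apply: measurableT_comp; [exact: measurable_kappa|exact: measurable_funB].
have B0 : 0 < B by rewrite (lt_le_trans _ B1).
have IS k m1 m2 : (\int[mu]_y ((ck k * wgt_mass a ^+ 2 / 2)%:E *
     (kappa (e k) B (y - m1) + kappa (e k) B (y - m2))) <= (ak k)%:E)%E.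
  rewrite ge0_integralZl_EFin//; last 2 first.
  - by move=> y _; rewrite adde_ge0// kappa_ge0.
  - exact: emeasurable_funD.
  rewrite ge0_integralD// => [|y _|y _]; try exact: kappa_ge0.
  rewrite !integral_kappa// -EFinD -EFinM lee_fin le_eqVlt; apply/orP; left; apply/eqP.
  by rewrite /ak; field.
have W_ge0 k xi : 0 <= ck k * gwgt dir a (e k) xi by rewrite mulr_ge0// gwgt_ge0.
have ig k : (leb3 R).-integrable setT (EFin \o gwgt dir a (e k)) by exact: integrable_gwgt.
have iW k : (leb3 R).-integrable setT (EFin \o fun xi => ck k * gwgt dir a (e k) xi).
  exact: integrable_realZ.
have W0_le xi : ((wgt3 a xi)%:E <= \sum_(k <oo) (ck k * gwgt dir a (e k) xi)%:E)%E.
  have -> : wgt3 a xi = wgt a (coord (~~ dir) xi) * wgt a xi.2 * wgt a (coord dir xi).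
    by case: (dir) => /=; rewrite /wgt3; ring.
  have ww0 : 0 <= wgt a (coord (~~ dir) xi) * wgt a xi.2 by rewrite mulr_ge0// ltW ?wgt_gt0.
  rewrite EFinM; apply: (@le_trans _ _ ((wgt a (coord (~~ dir) xi) * wgt a xi.2)%:E *
    \sum_(k <oo) (ck k * gauss (e k) (coord dir xi))%:E)%E).
    by rewrite lee_wpmul2l ?lee_fin// /ck /e; apply: wgt_le; lra.
  rewrite -nneseriesZl => [|k _]; last by rewrite lee_fin mulr_ge0 ?gauss_ge0.
  rewrite le_eqVlt; apply/orP; left; apply/eqP; apply: eq_eseriesr => k _.
  by rewrite -EFinM /gwgt; congr EFin; ring.
have mS k : measurable_fun setT (S k).
  apply: measurable_funeM; apply: emeasurable_funD; apply: mkap.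
    exact: measurable_funB.
  exact: measurable_funD.
have ak0 k : 0 <= ak k.
  apply: mulr_ge0; first by rewrite mulr_ge0 ?sqr_ge0.
  by rewrite mulr_ge0 ?sqrtr_ge0// mulr_ge0// sqr_ge0.
have S1 k x : (\int[mu]_y S k (x, y) <= (ak k)%:E)%E.
  apply: le_trans (IS k x (- x)); rewrite le_eqVlt; apply/orP; left; apply/eqP.
  apply: eq_integral => y _; rewrite /S /= -kappaN opprB opprK; congr (_ * (_ + kappa _ _ _))%E.
  by rewrite addrC.
have S2 k y : (\int[mu]_x S k (x, y) <= (ak k)%:E)%E.
  apply: le_trans (IS k y (- y)); rewrite le_eqVlt; apply/orP; left; apply/eqP.
  by apply: eq_integral => x _; rewrite /S /= opprK.
have KS k x y : (`|\int[leb3 R]_xi (ck k * gwgt dir a (e k) xi * c (x, xi) * c (y, xi))|%:E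
    <= S k (x, y))%E.
  (* [sg] is -1 or 1: positions, times and shifts combine linearly, so the combined phase is again
     of the form [phase3]. *)
  pose pm (sg : R) : R3 R := ((pos x).1.1 + sg * (pos y).1.1,
    (pos x).1.2 + sg * (pos y).1.2, (pos x).2 + sg * (pos y).2).
  pose I sg := \int[leb3 R]_xi (gwgt dir a (e k) xi *
     cos (phase3 (pm sg) (tau x + sg * tau y) (b + sg * b) xi)).
  have iI sg : (leb3 R).-integrable setT (EFin \o fun xi => gwgt dir a (e k) xi *
     cos (phase3 (pm sg) (tau x + sg * tau y) (b + sg * b) xi)).
    apply: integrable_bddM => //; last by exists 1 => xi; exact: cos_max.
    apply: measurableT_comp; first exact: measurable_cos.
    exact: measurable_phase3.
  have EI : \int[leb3 R]_xi (ck k * gwgt dir a (e k) xi * c (x, xi) * c (y, xi)) =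
      ck k / 2 * (I (- 1) + I 1).
    rewrite -RintegralD// -RintegralZl//; last exact: integrable_realD.
    apply: eq_Rintegral => xi _.
    have ph sg : phase3 (pm sg) (tau x + sg * tau y) (b + sg * b) xi =
        phase3 (pos x) (tau x) b xi + sg * phase3 (pos y) (tau y) b xi.
      by rewrite /phase3 /dot3 /pm /=; ring.
    by rewrite !ph mul1r mulN1r cosB cosD /c/=; field.
  have cpm sg : coord dir (pm sg) = x + sg * y.
    by rewrite -[in RHS](cpos x) -[in RHS](cpos y) /pm; case: (dir).
  have bI sg : (sg == 1) || (sg == - 1) ->
      (`|I sg|%:E <= (wgt_mass a ^+ 2)%:E * kappa (e k) B (x + sg * y))%E.
    move=> sg1; rewrite -cpm; apply: kernel_le_kappa => //; apply: etB.
    have /andP[x0 xT] := tauT x; have /andP[y0 yT] := tauT y.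
    by case/orP: sg1 => /eqP ->; rewrite ler_norml; lra.
  rewrite EI normrM ger0_norm ?divr_ge0// EFinM.
  apply: (@le_trans _ _ ((ck k / 2)%:E * ((wgt_mass a ^+ 2)%:E * kappa (e k) B (x - y) +
    (wgt_mass a ^+ 2)%:E * kappa (e k) B (x + y)))%E).
    rewrite lee_wpmul2l ?lee_fin ?divr_ge0//.
    apply: (@le_trans _ _ (`|I (- 1)| + `|I 1|)%:E); first by rewrite lee_fin ler_normD.
    rewrite EFinD leeD//.
      by have := bI (- 1); rewrite eqxx orbT mulN1r; apply.
    by have := bI 1; rewrite eqxx mul1r; apply.
  rewrite -ge0_muleDr ?kappa_ge0// muleA -EFinM /S le_eqVlt; apply/orP; left; apply/eqP.
  by congr (_%:E * _)%E; ring.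
have a_le : (\sum_(k <oo) (ak k)%:E <= (schur_const a T)%:E)%E.
  rewrite (_ : (\sum_(k <oo) _)%E = (\sum_(k <oo) (expR 4 * wgt_mass a ^+ 2 * 16 * B ^+ 2 *
     Num.sqrt pi * (2 * 4 `^ (- a)) ^+ k)%:E)%E).
    rewrite nneseries_geometric; first by rewrite lee_fin lerDl.
    by rewrite powR4_lt// mulr_ge0// powR_ge0.
  apply: eq_eseriesr => k _; congr EFin.
  by rewrite /ak /ck /e sqrt_pi_dyadic exprMn; ring.
have mWV : measurable_fun setT (fun xi => (wgt3 a xi)^-1).
  by under eq_fun do rewrite wgt3V; exact: measurable_wgt3.
pose D (n : nat) : set (measurableTypeR R) := `[(- n%:R), n%:R]%classic.
have mD n : measurable (D n) by exact: measurable_itv.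
have ndD : nondecreasing_seq D.
  move=> m n mn; apply/subsetPset => x /=; rewrite /D/= !in_itv/= -!ler_norml => /le_trans; apply.
  by rewrite ler_nat.
have DT : \bigcup_n D n = setT.
  apply/seteqP; split => // x _; exists (Num.truncn `|x|).+1 => //=.
  by rewrite /D/= in_itv/= -ler_norml ltW// truncnS_gt.
have Dfin n : (mu (D n) < +oo)%E.
  by rewrite lebesgue_measure_itv/=; case: ifP => // _; rewrite -EFinB ltry.
have H := @ttstar_bound _ _ _ _ _ mu (sfprod (sfprod mu mu) mu) c mc (fun z => cos_max _)
  (wgt3 a) _ S ak (schur_const a T) (wgt3_gt0 a) (measurable_wgt3 a) mWV W_ge0 iW W0_le
  mS ak0 KS S1 S2 (schur_const_gt0 T a2) a_le D f mD ndD DT Dfin jf.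
exact: H.
Qed.

End linearized.

(** * Suprema over a countable grid *)

Section grid.
Context {R : realType}.

(** The mesh is [1 / m.+1] for every [m], not only powers of two. *)
Definition dyadic_floor (m : nat) (y : R) : R := (Num.floor (y * m.+1%:R))%:~R / m.+1%:R.

Lemma cvg_dyadic_floor (y : R) : dyadic_floor m y @[m --> \oo] --> y.
Proof.
apply/cvgrPdist_le => e e0.
have := @cvg_harmonic R => /cvgrPdist_le /(_ e e0); apply: filterS => m.
rewrite sub0r normrN ger0_norm ?invr_ge0// => /(le_trans _); apply.
have m0 : 0 < m.+1%:R :> R by [].
have /andP[f1 f2] := floor_itv (y * m.+1%:R).
rewrite intrD in f2; rewrite /dyadic_floor.
have -> : y - (Num.floor (y * m.+1%:R))%:~R / m.+1%:R =
    (y * m.+1%:R - (Num.floor (y * m.+1%:R))%:~R) / m.+1%:R.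
  by rewrite mulrBl mulfK// gt_eqF.
rewrite normrM (ger0_norm (x := _^-1)) ?invr_ge0// ler_piMl ?invr_ge0//.
by rewrite ler_norml; lra.
Qed.

(** Grid points carry arbitrary rational times; clipping brings them into [[0, T]], and since it is
    continuous and the identity there, approximation survives. *)
Definition clip (T t : R) : R := Num.min (Num.max t 0) T.

Lemma clip_itv T t : 0 <= T -> 0 <= clip T t <= T.
Proof. by move=> T0; rewrite /clip le_min le_max lexx orbT T0 ge_min lexx orbT. Qed.

Lemma clip_id T t : 0 <= t <= T -> clip T t = t.
Proof. by move=> /andP[t0 tT]; rewrite /clip max_l// min_l. Qed.

Lemma cvg_clip T (u : nat -> R) t : u n @[n --> \oo] --> t ->
  clip T (u n) @[n --> \oo] --> clip T t.
Proof.
move=> ut; suff : {for t, continuous (clip T)} by apply: (cvg_comp _ _ ut).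
apply: continuous_min; last exact: cvg_cst.
by apply: continuous_max; [exact: cvg_id|exact: cvg_cst].
Qed.

Definition grid_point T (j : nat * (int * int * int)) : R3 R :=
  (j.2.1.1%:~R / j.1.+1%:R, j.2.1.2%:~R / j.1.+1%:R, clip T (j.2.2%:~R / j.1.+1%:R)).

(** Integers that decode to no index are sent to the point of index 0, whose time is clipped as
    well. *)
Definition grid T (n : nat) : R3 R :=
  if unpickle n is Some j then grid_point T j else grid_point T (0%N, (0, 0, 0)).

Definition grid_near T (q : R3 R) (m : nat) : R3 R :=
  (dyadic_floor m q.1.1, dyadic_floor m q.1.2, clip T (dyadic_floor m q.2)).

Lemma grid_nearP T q m : exists n, grid T n = grid_near T q m.
Proof.
exists (pickle (m, (Num.floor (q.1.1 * m.+1%:R), Num.floor (q.1.2 * m.+1%:R),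
  Num.floor (q.2 * m.+1%:R)))).
by rewrite /grid pickleK.
Qed.

Lemma grid_time T n : 0 <= T -> 0 <= (grid T n).2 <= T.
Proof.
by move=> T0; rewrite /grid; case: unpickle => [j|]; exact: clip_itv.
Qed.

End grid.

(** * Running maxima over the grid *)

Section maximal.
Context {R : realType}.
Notation mu := (@lebesgue_measure R).
Variables (dir : bool) (a T b : R) (f : R3 R -> R).
Hypotheses (a2 : 2^-1 < a) (T0 : 0 <= T)
  (jf : (leb3 R).-integrable setT (EFin \o f)).

(* [q] holds the other horizontal coordinate, the height and the time. *)
Definition insert (x : R) (q : R3 R) : R3 R :=
  if dir then (x, q.1.1, q.1.2) else (q.1.1, x, q.1.2).

Definition osc_at (x : R) (q : R3 R) : R :=
  \int[leb3 R]_xi (f xi * cos (phase3 (insert x q) q.2 b xi)).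

(** A running argmax: among the first [n + 1] grid points it keeps one where [|osc_at x|] is
    largest. It is measurable with values in a finite set, hence an admissible linearization. *)
Fixpoint selector (n : nat) (x : measurableTypeR R) : R3 R :=
  if n is m.+1 then
    if `|osc_at x (selector m x)| < `|osc_at x (grid T m.+1)| then grid T m.+1
    else selector m x
  else grid T 0.

Lemma selector_time n x : 0 <= (selector n x).2 <= T.
Proof.
elim: n => [|n IH]; first exact: (grid_time 0).
by rewrite [selector _ _]/=; case: ifP => // _; exact: (grid_time n.+1).
Qed.

Lemma le_selectorS n x :
  `|osc_at x (selector n x)| <= `|osc_at x (selector n.+1 x)|.
Proof. by rewrite /=; case: ifPn => // /ltW. Qed.

Lemma le_grid_selector n x :
  `|osc_at x (grid T n)| <= `|osc_at x (selector n x)|.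
Proof.
case: n => [//|n]; rewrite [selector _ _]/=.
by case: ifPn => //; rewrite -leNgt.
Qed.

Let mf : measurable_fun setT f.
Proof. by apply/measurable_EFinP; exact: (measurable_int (leb3 R)). Qed.

Lemma measurable_insert (h : measurableTypeR R -> R3 R) : measurable_fun setT h ->
  measurable_fun setT (fun x => insert x (h x)).
Proof.
move=> mh; rewrite /insert; case: dir.
- apply: measurable_fun_pair; [apply: measurable_fun_pair => //|].
    exact: (measurableT_comp measurable_pr11).
  exact: (measurableT_comp measurable_pr12).
- apply: measurable_fun_pair; [apply: measurable_fun_pair => //|].
    exact: (measurableT_comp measurable_pr11).
  exact: (measurableT_comp measurable_pr12).
Qed.

Lemma measurable_osc_at (h : measurableTypeR R -> R3 R) : measurable_fun setT h ->
  measurable_fun setT (fun x => osc_at x (h x)).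
Proof.
move=> mh; have mi := measurable_insert mh.
apply: (@measurable_Rintegral_snd _ _ _ _ _ (sfprod (sfprod mu mu) mu)
  (fun z => f z.2 * cos (phase3 (insert z.1 (h z.1)) (h z.1).2 b z.2))).
apply: measurable_funM; first exact: measurableT_comp.
apply: measurableT_comp; first exact: measurable_cos.
have mi1 : measurable_fun setT (fun z : measurableTypeR R * R3 R => insert z.1 (h z.1)).
  exact: (measurableT_comp mi).
have mh1 : measurable_fun setT (fun z : measurableTypeR R * R3 R => h z.1).
  exact: (measurableT_comp mh).
apply: measurable_funD => //; apply: measurable_funB.
  apply: measurable_funD; [apply: measurable_funD|]; apply: measurable_funM.
  - exact: (measurableT_comp measurable_pr11).
  - exact: (measurableT_comp measurable_pr11).
  - exact: (measurableT_comp measurable_pr12).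
  - exact: (measurableT_comp measurable_pr12).
  - exact: (measurableT_comp measurable_snd).
  - exact: (measurableT_comp measurable_snd).
apply: measurable_funM; first exact: (measurableT_comp measurable_snd mh1).
exact: (measurableT_comp measurable_symbol).
Qed.

Lemma measurable_selector n : measurable_fun setT (selector n).
Proof.
elim: n => [|n IH] /=; first exact: measurable_cst.
apply: measurable_fun_ifT => //.
apply: measurable_fun_ltr; apply: measurableT_comp => //; exact: measurable_osc_at.
Qed.

(** The limit of increasing running maxima, that is, the supremum of the squares over the grid,
    obtained as a measurable function of [x]. *)
Definition maximal_sqr (x : measurableTypeR R) : \bar R :=
  limn (fun n => (osc_at x (selector n x) ^+ 2)%:E).

Let nd x : nondecreasing_seq (fun n => (osc_at x (selector n x) ^+ 2)%:E).
Proof.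
apply/nondecreasing_seqP => n; rewrite lee_fin.
rewrite -(real_normK (num_real (osc_at x (selector n x)))).
rewrite -(real_normK (num_real (osc_at x (selector n.+1 x)))).
by rewrite ler_pXn2r ?nnegrE//; exact: le_selectorS.
Qed.

Let msel n : measurable_fun setT (fun x => (osc_at x (selector n x) ^+ 2)%:E).
Proof.
apply/measurable_EFinP; apply: measurable_funX; apply: measurable_osc_at.
exact: measurable_selector.
Qed.

Lemma measurable_maximal_sqr : measurable_fun setT maximal_sqr.
Proof.
apply: (emeasurable_fun_cvg (fun n x => (osc_at x (selector n x) ^+ 2)%:E)) => // x _.
exact: ereal_nondecreasing_is_cvgn.
Qed.

Lemma maximal_sqr_ge0 x : (0 <= maximal_sqr x)%E.
Proof.
apply: lime_ge; first exact: ereal_nondecreasing_is_cvgn.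
by apply: nearW => n; rewrite lee_fin sqr_ge0.
Qed.

(** The bound for linearized operators is uniform in [n], so it passes to the limit by monotone
    convergence. *)
Lemma integral_maximal_sqr :
  (\int[mu]_x maximal_sqr x
    <= (schur_const a T)%:E * \int[leb3 R]_xi (f xi ^+ 2 / wgt3 a xi)%:E)%E.
Proof.
rewrite monotone_convergence//; last by move=> n x _; rewrite lee_fin sqr_ge0.
apply: lime_le.
  apply: ereal_nondecreasing_is_cvgn => m n mn; apply: ge0_le_integral; try exact: msel.
  - exact: measurableT.
  - by move=> x _; rewrite lee_fin sqr_ge0.
  - by move=> x _; exact: nd.
apply: nearW => n.
apply: (@linearized_maximal _ dir a T b (fun x => insert x (selector n x))
  (fun x => (selector n x).2)) => //.
- by apply: measurable_insert; exact: measurable_selector.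
- by apply: (measurableT_comp measurable_snd); exact: measurable_selector.
- by move=> x; rewrite /insert; case: dir.
- by move=> x; exact: selector_time.
Qed.

(** The phase is continuous in the point and the time, and [|f|] dominates the integrands. *)
Lemma cvg_osc_at x (q : R3 R) : 0 <= q.2 <= T ->
  osc_at x (grid_near T q m) @[m --> \oo] --> osc_at x q.
Proof.
move=> q2; have cq1 := @cvg_dyadic_floor R q.1.1; have cq2 := @cvg_dyadic_floor R q.1.2.
have cq3 : clip T (dyadic_floor m q.2) @[m --> \oo] --> (q.2 : R).
  by rewrite -[X in _ --> X](clip_id q2); apply: cvg_clip; exact: cvg_dyadic_floor.
pose F m xi := f xi * cos (phase3 (insert x (grid_near T q m)) (grid_near T q m).2 b xi).
pose G xi := f xi * cos (phase3 (insert x q) q.2 b xi).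
have mF m : measurable_fun setT (EFin \o F m).
  apply/measurable_EFinP; apply: measurable_funM => //.
  by apply: measurableT_comp; [exact: measurable_cos|exact: measurable_phase3].
have mG : measurable_fun setT (EFin \o G).
  apply/measurable_EFinP; apply: measurable_funM => //.
  by apply: measurableT_comp; [exact: measurable_cos|exact: measurable_phase3].
have FG xi : F m xi @[m --> \oo] --> G xi.
  apply: cvgM; first exact: cvg_cst.
  suff P : phase3 (insert x (grid_near T q m)) (grid_near T q m).2 b xi @[m --> \oo] -->
      phase3 (insert x q) q.2 b xi.
    by apply: (cvg_comp _ _ P); exact: continuous_cos.
  apply: cvgD; last exact: cvg_cst.
  apply: cvgB; last by apply: cvgM => //; exact: cvg_cst.
  rewrite /dot3 /insert /grid_near; case: dir => /=; apply: cvgD; try apply: cvgD;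
    apply: cvgM => //; exact: cvg_cst.
have [] := @dominated_convergence _ _ _ (leb3 R) setT measurableT (fun m => EFin \o F m)
  (EFin \o G) (abse \o (EFin \o f)) mF mG.
- by apply: aeW => xi _; apply: cvg_EFin; [exact: nearW|exact: FG].
- exact: integrable_abse.
- apply: aeW => xi m _; rewrite /= lee_fin normrM ler_piMr//; exact: cos_max.
move=> iG _ L.
apply: fine_cvg; rewrite /osc_at /Rintegral fineK; last exact: (integrable_fin_num measurableT iG).
exact: L.
Qed.

(** Every admissible point is a limit of grid points, so the grid controls the supremum everywhere
    and not just almost everywhere. *)
Lemma osc_at_le_maximal x (q : R3 R) : 0 <= q.2 <= T ->
  ((osc_at x q ^+ 2)%:E <= maximal_sqr x)%E.
Proof.
move=> q2.
have C : (osc_at x (grid_near T q m) ^+ 2)%:E @[m --> \oo] --> (osc_at x q ^+ 2)%:E.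
  apply: cvg_EFin; first exact: nearW.
  by rewrite expr2; under eq_fun do rewrite expr2; apply: cvgM; exact: cvg_osc_at.
rewrite -(cvg_lim _ C)//; apply: lime_le; first by apply/cvg_ex; eexists; exact: C.
apply: nearW => m; have [n <-] := grid_nearP T q m.
apply: (@le_trans _ _ (osc_at x (selector n x) ^+ 2)%:E).
  rewrite lee_fin -(real_normK (num_real (osc_at x (grid T n)))).
  rewrite -(real_normK (num_real (osc_at x (selector n x)))).
  by rewrite ler_pXn2r ?nnegrE//; exact: le_grid_selector.
have := ereal_nondecreasing_cvgn (nd x) => /cvg_lim E; rewrite /maximal_sqr E//.
by apply: ereal_sup_ubound; exists n.
Qed.

End maximal.

(** * Fourier transforms and the unitary group *)

Section complex_integrals.
Context {R : realType}.
Notation mu := (@lebesgue_measure R).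
Implicit Types (t b s sg : R) (v w xi : R3 R) (f g : R3 R -> R[i]).

Lemma Re_expiM t (z : R[i]) :
  complex.Re (expi t * z) = cos t * complex.Re z - sin t * complex.Im z.
Proof. by case: z. Qed.

Lemma Im_expiM t (z : R[i]) :
  complex.Im (expi t * z) = cos t * complex.Im z + sin t * complex.Re z.
Proof. by case: z. Qed.

Lemma expiM s t : expi s * expi t = expi (s + t) :> R[i].
Proof. by rewrite /expi cosD sinD; congr (_ +i* _); rewrite addrC. Qed.

Lemma sqr_normc (z : R[i]) : normc z ^+ 2 = complex.Re z ^+ 2 + complex.Im z ^+ 2.
Proof. by case: z => x y /=; rewrite sqr_sqrtr// addr_ge0// sqr_ge0. Qed.

Lemma measurable_dot3 : measurable_fun setT (fun z : R3 R * R3 R => dot3 z.1 z.2).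
Proof.
have m1 : measurable_fun setT (fun z : R3 R * R3 R => z.1) by exact: measurable_fst.
have m2 : measurable_fun setT (fun z : R3 R * R3 R => z.2) by exact: measurable_snd.
apply: measurable_funD; [apply: measurable_funD|]; apply: measurable_funM.
- exact: (measurableT_comp measurable_pr11).
- exact: (measurableT_comp measurable_pr11).
- exact: (measurableT_comp measurable_pr12).
- exact: (measurableT_comp measurable_pr12).
- exact: (measurableT_comp measurable_snd).
- exact: (measurableT_comp measurable_snd).
Qed.

Lemma measurable_sin : measurable_fun [set: measurableTypeR R] (@sin R).
Proof. by apply: continuous_measurable_fun; exact: continuous_sin. Qed.

Lemma cmeasurable_fourier_integral sg f : cmeasurable f ->
  cmeasurable (fourier_integral sg f).
Proof.
move=> [mr mi].
have ms : measurable_fun setT (fun z : R3 R * R3 R => sg * dot3 z.1 z.2).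
  by apply: measurable_funM => //; exact: measurable_dot3.
have mc := measurableT_comp measurable_cos ms.
have msn := measurableT_comp measurable_sin ms.
have mr1 : measurable_fun setT (fun z : R3 R * R3 R => complex.Re (f z.1)).
  exact: (measurableT_comp mr measurable_fst).
have mi1 : measurable_fun setT (fun z : R3 R * R3 R => complex.Im (f z.1)).
  exact: (measurableT_comp mi measurable_fst).
pose K : R := (2 * pi) `^ (- (3 / 2)).
split.
- rewrite (_ : (fun w => _) = (fun w => K * \int[leb3 R]_v complex.Re (expi (sg * dot3 v w) * f v))).
    apply: measurable_funM => //.
    apply: (@measurable_Rintegral_fst _ _ _ _ _ (sfprod (sfprod mu mu) mu)
      (fun z : R3 R * R3 R => complex.Re (expi (sg * dot3 z.1 z.2) * f z.1))).
    rewrite (_ : (fun z => _) = (fun z : R3 R * R3 R =>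
        cos (sg * dot3 z.1 z.2) * complex.Re (f z.1) - sin (sg * dot3 z.1 z.2) * complex.Im (f z.1))).
      by apply: measurable_funB; apply: measurable_funM.
    by apply/funext => z; rewrite Re_expiM.
  by apply/funext => w; rewrite /fourier_integral /cintegral /= mul0r subr0.
- rewrite (_ : (fun w => _) = (fun w => K * \int[leb3 R]_v complex.Im (expi (sg * dot3 v w) * f v))).
    apply: measurable_funM => //.
    apply: (@measurable_Rintegral_fst _ _ _ _ _ (sfprod (sfprod mu mu) mu)
      (fun z : R3 R * R3 R => complex.Im (expi (sg * dot3 z.1 z.2) * f z.1))).
    rewrite (_ : (fun z => _) = (fun z : R3 R * R3 R =>
        cos (sg * dot3 z.1 z.2) * complex.Im (f z.1) + sin (sg * dot3 z.1 z.2) * complex.Re (f z.1))).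
      by apply: measurable_funD; apply: measurable_funM.
    by apply/funext => z; rewrite Im_expiM.
  by apply/funext => w; rewrite /fourier_integral /cintegral /= mul0r addr0.
Qed.

(** Off the integrable case the transform is a chosen element of [L2], or the zero function if there
    is none to choose. *)
Lemma cmeasurable_fourier f : cmeasurable f -> cmeasurable (fourier f).
Proof.
move=> mf; rewrite /fourier /fourier_transform; case: ifP => _.
  exact: cmeasurable_fourier_integral.
by case: xgetP => [g _ [[]]//|_]; split; exact: measurable_cst.
Qed.

(** The multiplier has modulus one, so the product stays integrable and the inverse transform takes
    its integral branch. *)
Lemma unitary_groupE t f v : cintegrable (fourier f) ->
  unitary_group t f v = fourier_integral 1 (fun w : R3 R =>
    expi (- (t * symbol w)) * fourier f w) v.
Proof.
move=> [ir ii]; rewrite /unitary_group /inv_fourier /fourier_transform.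
rewrite ifT//; apply/asboolP.
have mt : measurable_fun setT (fun w : R3 R => - (t * symbol w)).
  by apply: measurableT_comp => //; apply: measurable_funM => //; exact: measurable_symbol.
have mc := measurableT_comp measurable_cos mt.
have ms := measurableT_comp measurable_sin mt.
have bc (h : R3 R -> R) : (leb3 R).-integrable setT (EFin \o h) ->
    (leb3 R).-integrable setT (EFin \o fun w => cos (- (t * symbol w)) * h w).
  move=> ih; under eq_fun do rewrite mulrC; apply: integrable_bddM => //.
  by exists 1 => w; exact: cos_max.
have bs (h : R3 R -> R) : (leb3 R).-integrable setT (EFin \o h) ->
    (leb3 R).-integrable setT (EFin \o fun w => sin (- (t * symbol w)) * h w).
  move=> ih; under eq_fun do rewrite mulrC; apply: integrable_bddM => //.
  by exists 1 => w; exact: sin_max.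
split.
- under eq_fun do rewrite Re_expiM.
  by apply: integrable_realB; [exact: bc|exact: bs].
- under eq_fun do rewrite Im_expiM.
  by apply: integrable_realD; [exact: bc|exact: bs].
Qed.

End complex_integrals.

(** * Reduction to cosine integrals and to the Sobolev weight *)

Section estimate.
Context {R : realType}.
Notation mu := (@lebesgue_measure R).
Implicit Types (t b s T : R) (v w xi : R3 R) (f g : R3 R -> R[i]).

Definition fourier_const : R := (2 * pi) `^ (- (3 / 2)).

Definition fourier_re f w : R := complex.Re (fourier f w).

Definition fourier_im f w : R := complex.Im (fourier f w).

(** The real and imaginary parts of the integral are each a combination of two cosine integrals,
    sines being cosines shifted by [- pi / 2]. *)
Lemma normc_unitary_group dir t f x (q : R3 R) :
  cintegrable (fourier f) ->
  normc (unitary_group q.2 f (insert dir x q)) ^+ 2 <=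
  4 * fourier_const ^+ 2 *
    (osc_at dir 0 (fourier_re f) x q ^+ 2 +
     osc_at dir (- (pi / 2)) (fourier_im f) x q ^+ 2 +
     osc_at dir 0 (fourier_im f) x q ^+ 2 +
     osc_at dir (- (pi / 2)) (fourier_re f) x q ^+ 2).
Proof.
move=> cif; have [ir ii] := cif.
set r := fourier_re f; set i := fourier_im f.
rewrite unitary_groupE//; set v := insert dir x q; set t' := q.2.
have K0 : 0 <= fourier_const by exact: powR_ge0.
have ph xi : 1 * dot3 xi v + - (t' * symbol xi) = phase3 v t' 0 xi.
  by rewrite /phase3 /dot3; ring.
have ic (h : R3 R -> R) b : (leb3 R).-integrable setT (EFin \o h) ->
    (leb3 R).-integrable setT (EFin \o fun w => h w * cos (phase3 v t' b w)).
  move=> ih; apply: integrable_bddM => //; last by exists 1 => w; exact: cos_max.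
  by apply: measurableT_comp; [exact: measurable_cos|exact: measurable_phase3].
have sn xi : sin (phase3 v t' 0 xi) = cos (phase3 v t' (- (pi / 2)) xi).
  by rewrite -cosBpihalf /phase3 addr0.
rewrite sqr_normc /fourier_integral /cintegral /= !mul0r subr0 addr0.
rewrite (_ : \int[leb3 R]_xi complex.Re _ = osc_at dir 0 r x q - osc_at dir (- (pi / 2)) i x q); last first.
  rewrite /osc_at -RintegralB//; try exact: ic.
  apply: eq_Rintegral => xi _.
  by rewrite mulrA expiM Re_expiM ph sn -/v -/t' /r /i mulrC [in X in _ - X]mulrC.
rewrite (_ : \int[leb3 R]_xi complex.Im _ = osc_at dir 0 i x q + osc_at dir (- (pi / 2)) r x q); last first.
  rewrite /osc_at -RintegralD//; try exact: ic.
  apply: eq_Rintegral => xi _.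
  by rewrite mulrA expiM Im_expiM ph sn -/v -/t' /r /i mulrC [in X in _ + X]mulrC.
rewrite -/fourier_const.
move: (osc_at dir 0 r x q) (osc_at dir (- (pi / 2)) i x q) (osc_at dir 0 i x q)
  (osc_at dir (- (pi / 2)) r x q) => A1 A2 A3 A4.
(* Up to [fourier_const ^+ 2], this is the right-hand side minus the left-hand side, written as a
   sum of squares. *)
have h0 : 0 <= (A1 + A2) ^+ 2 + (A3 - A4) ^+ 2 + 2 * (A1 ^+ 2 + A2 ^+ 2 + A3 ^+ 2 + A4 ^+ 2).
  by rewrite !addr_ge0 ?sqr_ge0// mulr_ge0// !addr_ge0 ?sqr_ge0.
rewrite -subr_ge0 (_ : _ - _ = fourier_const ^+ 2 * ((A1 + A2) ^+ 2 + (A3 - A4) ^+ 2 +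
   2 * (A1 ^+ 2 + A2 ^+ 2 + A3 ^+ 2 + A4 ^+ 2))); last by ring.
by rewrite mulr_ge0// sqr_ge0.
Qed.

Lemma sqr_poweR12 (x : \bar R) : (0 <= x)%E -> ((x `^ 2^-1) `^ 2 = x)%E.
Proof. by move=> x0; rewrite -poweRrM mulVf// poweRe1. Qed.

Lemma EFin_sqr_poweR (x : R) : ((`|x|%:E) `^ 2 = (x ^+ 2)%:E)%E.
Proof. by rewrite /= -(real_normK (num_real x)) powR_mulrn. Qed.

Definition sobolev_energy s f : \bar R :=
  (\int[leb3 R]_w ((1 + dot3 w w) `^ s *
    (complex.Re (fourier f w) ^+ 2 + complex.Im (fourier f w) ^+ 2))%:E)%E.

Lemma dot3_ge0 w : 0 <= dot3 w w.
Proof. by rewrite /dot3 -!expr2 !addr_ge0 ?sqr_ge0. Qed.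

Lemma sobolev_normE s f : sobolev_norm s f = (sobolev_energy s f `^ 2^-1)%E.
Proof.
rewrite /sobolev_norm /L2norm unlock; congr (_ `^ _)%E; apply: eq_integral => w _.
have p0 : 0 < 1 + dot3 w w by rewrite ltr_wpDr// dot3_ge0.
rewrite EFin_sqr_poweR normcM exprMn !sqr_normc /= expr0n/= addr0; congr (_ * _)%:E.
by rewrite -powR_mulrn ?powR_ge0// -powRrM divfK.
Qed.

(** Each of the three factors is at most [(1 + |w|^2)^(s/3)], and the exponents add up to [s]. *)
Lemma wgt3V_le s w : 0 <= s -> (wgt3 (s / 3) w)^-1 <= (1 + dot3 w w) `^ s.
Proof.
move=> s0; rewrite wgt3V /wgt3 /wgt opprK.
have a0 : 0 <= s / 3 by rewrite divr_ge0.
have D := dot3_ge0 w.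
have le1 x : x ^+ 2 <= dot3 w w -> (1 + x ^+ 2) `^ (s / 3) <= (1 + dot3 w w) `^ (s / 3).
  move=> h; apply: ge0_ler_powR => //; rewrite ?nnegrE ?addr_ge0 ?sqr_ge0//.
  by rewrite lerD2l.
have -> : (1 + dot3 w w) `^ s = (1 + dot3 w w) `^ (s / 3) * (1 + dot3 w w) `^ (s / 3) *
    (1 + dot3 w w) `^ (s / 3).
  have p0 : 1 + dot3 w w != 0 by rewrite gt_eqF// ltr_wpDr.
  have pD (u r : R) : (1 + dot3 w w) `^ u * (1 + dot3 w w) `^ r = (1 + dot3 w w) `^ (u + r).
    by rewrite powRD//; apply/implyP => _.
  by rewrite !pD; congr (_ `^ _); field.
have dE : dot3 w w = w.1.1 ^+ 2 + w.1.2 ^+ 2 + w.2 ^+ 2 by rewrite /dot3 -!expr2.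
have [x0 y0 z0] : [/\ 0 <= w.1.1 ^+ 2, 0 <= w.1.2 ^+ 2 & 0 <= w.2 ^+ 2].
  by split; exact: sqr_ge0.
apply: ler_pM; [by rewrite mulr_ge0 ?powR_ge0|exact: powR_ge0| |].
  by apply: ler_pM; [exact: powR_ge0|exact: powR_ge0| |]; apply: le1; lra.
by apply: le1; lra.
Qed.

Lemma weighted_le_energy s f (h : R3 R -> R) : 0 <= s ->
  cmeasurable (fourier f) -> measurable_fun setT h ->
  (forall w, h w ^+ 2 <= complex.Re (fourier f w) ^+ 2 + complex.Im (fourier f w) ^+ 2) ->
  (\int[leb3 R]_xi (h xi ^+ 2 / wgt3 (s / 3) xi)%:E <= sobolev_energy s f)%E.
Proof.
move=> s0 [mr mi] mh hle; apply: ge0_le_integral => //.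
- by move=> w _; rewrite lee_fin divr_ge0 ?sqr_ge0// ltW ?wgt3_gt0.
- apply/measurable_EFinP; apply: measurable_funM; first exact: measurable_funX.
  by under eq_fun do rewrite wgt3V; exact: measurable_wgt3.
- apply/measurable_EFinP; apply: measurable_funM.
    apply: (measurableT_comp (measurable_powR s)).
    apply: measurable_funD => //.
    apply: measurable_funD; [apply: measurable_funD|]; apply: measurable_funM;
      by [exact: measurable_pr11|exact: measurable_pr12|exact: measurable_snd].
  by apply: measurable_funD; exact: measurable_funX.
- move=> w _; rewrite lee_fin mulrC; apply: ler_pM; rewrite ?sqr_ge0//.
    by rewrite invr_ge0 ltW ?wgt3_gt0.
  exact: wgt3V_le.
Qed.

(** Pointwise [|h| <= h^2 / w + w], and both terms on the right are integrable; this plays the part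
    of the Cauchy-Schwarz inequality. *)
Lemma weighted_integrable a (h : R3 R -> R) : 2^-1 < a -> measurable_fun setT h ->
  (\int[leb3 R]_xi (h xi ^+ 2 / wgt3 a xi)%:E < +oo)%E ->
  (leb3 R).-integrable setT (EFin \o h).
Proof.
move=> a2 mh hoo.
have m2 : measurable_fun setT (fun xi => h xi ^+ 2 / wgt3 a xi).
  apply: measurable_funM; first exact: measurable_funX.
  by under eq_fun do rewrite wgt3V; exact: measurable_wgt3.
have p0 xi : 0 <= h xi ^+ 2 / wgt3 a xi by rewrite divr_ge0 ?sqr_ge0// ltW ?wgt3_gt0.
have i1 : (leb3 R).-integrable setT (EFin \o fun xi => h xi ^+ 2 / wgt3 a xi).
  apply/integrableP; split; first exact/measurable_EFinP.
  rewrite (eq_integral (fun xi => (h xi ^+ 2 / wgt3 a xi)%:E)) => [//|xi _].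
  by rewrite gee0_abs// lee_fin.
have i2 := integrable_realD i1 (integrable_wgt3 a2).
apply: le_integrable i2 => //; first exact/measurable_EFinP.
move=> xi _; rewrite lee_fin; apply: le_trans (ler_norm _).
have w0 := wgt3_gt0 a xi; rewrite -(real_normK (num_real (h xi))).
have := normr_ge0 (h xi); move: `|h xi| (wgt3 a xi) w0 => u w w0 u0.
rewrite -(@ler_pM2r _ w)// mulrDl divfK ?gt_eqF//.
by have := sqr_ge0 (u - w / 2); have := sqr_ge0 w; nra.
Qed.

End estimate.

(** * The mixed norms *)

Section mixed_norm.
Context {R : realType}.
Notation mu := (@lebesgue_measure R).
Implicit Types (s T : R) (f : R3 R -> R[i]).

(* The integral of a nonnegative function is a supremum of simple integrals, so
   it is monotone even on non-measurable functions. *)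
Lemma ge0_le_integral_nonmeasurable d (T : measurableType d) (m : {measure set T -> \bar R})
    (f g : T -> \bar R) : (forall x, (0 <= f x)%E) -> (forall x, (f x <= g x)%E) ->
  (\int[m]_x f x <= \int[m]_x g x)%E.
Proof.
move=> f0 fg; have g0 x : (0 <= g x)%E := le_trans (f0 x) (fg x).
rewrite !ge0_integralTE//; apply: le_ereal_sup => _ [h hf <-]; exists h => // x.
exact: le_trans (hf x) (fg x).
Qed.

Lemma Lnorm2E d (T : measurableType d) (m : {measure set T -> \bar R}) (F : T -> \bar R) :
  Lnorm m 2%:E F = ((\int[m]_x (`|F x| `^ 2)) `^ 2^-1)%E.
Proof. by rewrite unlock. Qed.

Lemma ge0_integral_sum4_le d (T : measurableType d) (m : {measure set T -> \bar R})
    (K A : R) (E : \bar R) (M1 M2 M3 M4 : T -> \bar R) : 0 <= K -> 0 <= A ->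
  measurable_fun setT M1 -> measurable_fun setT M2 ->
  measurable_fun setT M3 -> measurable_fun setT M4 ->
  (forall x, (0 <= M1 x)%E) -> (forall x, (0 <= M2 x)%E) ->
  (forall x, (0 <= M3 x)%E) -> (forall x, (0 <= M4 x)%E) ->
  (\int[m]_x M1 x <= A%:E * E)%E -> (\int[m]_x M2 x <= A%:E * E)%E ->
  (\int[m]_x M3 x <= A%:E * E)%E -> (\int[m]_x M4 x <= A%:E * E)%E ->
  (\int[m]_x (K%:E * (M1 x + M2 x + M3 x + M4 x)) <= (K * (4 * A))%:E * E)%E.
Proof.
move=> K0 A0 mM1 mM2 mM3 mM4 M10 M20 M30 M40 I1 I2 I3 I4.
have M120 x := adde_ge0 (M10 x) (M20 x).
have M1230 x := adde_ge0 (M120 x) (M30 x).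
have m12 := emeasurable_funD mM1 mM2; have m123 := emeasurable_funD m12 mM3.
have m1234 := emeasurable_funD m123 mM4.
rewrite (ge0_integralZl_EFin _ _ _ m1234)// => [|x _]; last exact: adde_ge0.
rewrite EFinM -muleA lee_wpmul2l ?lee_fin//.
rewrite (ge0_integralD _ _ _ m123)//.
rewrite (ge0_integralD _ _ _ m12)//.
rewrite ge0_integralD//.
have -> : (4 * A)%:E = (A%:E + A%:E + A%:E + A%:E)%E by rewrite -!EFinD; congr EFin; ring.
rewrite !ge0_muleDl ?adde_ge0 ?lee_fin//.
by do 3 (try apply: leeD).
Qed.

(** The complement of the slab is null for the restricted measure, so bounds on the slab pass to the
    essential supremum. *)
Lemma ae_leb_slab T (P : R3 R -> Prop) : (forall p : R3 R, 0 <= p.2 <= T -> P p) ->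
  {ae leb_slab T, forall p, P p}.
Proof.
move=> hP; exists (~` (setT `*` `[0, T]%classic)); split.
- by apply: measurableC; exact: measurable_slab.
- by rewrite /leb_slab /= /mrestr setICl measure0.
- move=> p nP [_ /=]; rewrite in_itv/= => pT; exact/nP/hP.
Qed.

Lemma Lnorm_slab_le T (F : R3 R -> R) (H : \bar R) : (0 <= H)%E ->
  (forall p : R3 R, 0 <= p.2 <= T -> ((F p ^+ 2)%:E <= H)%E) ->
  (`|Lnorm (leb_slab T) +oo (fun p => (F p)%:E)| `^ 2 <= H)%E.
Proof.
move=> H0 hF; have L0 : (0 <= Lnorm (leb_slab T) +oo (fun p => (F p)%:E))%E by exact: Lnorm_ge0.
rewrite gee0_abs//.
have L1 : (Lnorm (leb_slab T) +oo (fun p => (F p)%:E) <= H `^ 2^-1)%E.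
  (* On a space of measure zero the norm of exponent [+oo] is 0 by convention; this is the second
     branch. *)
  rewrite unlock; case: ifPn => _; last exact: poweR_ge0.
  apply/ess_supP; apply: ae_leb_slab => p pT /=.
  have := hF p pT; move: H0; case: H {hF} => [r| |//] r0; last by move=> _; rewrite /= invr_eq0 gt_eqF// leey.
  rewrite !lee_fin => Fr; rewrite powR12_sqrt// -sqrtr_sqr ler_sqrt//.
apply: (@le_trans _ _ ((H `^ 2^-1) `^ 2)%E); last by rewrite sqr_poweR12.
apply: gt0_ler_poweR => //; rewrite in_itv/= ?leey ?andbT//; exact: poweR_ge0.
Qed.

Definition maximal_norm (dir : bool) T (u : R -> R3 R -> R[i]) : \bar R :=
  Lnorm mu 2%:E (fun x : measurableTypeR R =>
    Lnorm (leb_slab T) +oo%E (fun p : R3 R => (normc (u p.2 (insert dir x p)))%:E)).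

Lemma norm_L2x_LinfyzTE T (u : R -> R3 R -> R[i]) :
  norm_L2x_LinfyzT T u = maximal_norm true T u.
Proof.
congr (Lnorm _ _ _); apply/funext => x; congr (Lnorm _ _ _).
by apply/funext => -[[y z] t].
Qed.

Lemma norm_L2y_LinfxzTE T (u : R -> R3 R -> R[i]) :
  norm_L2y_LinfxzT T u = maximal_norm false T u.
Proof.
congr (Lnorm _ _ _); apply/funext => y; congr (Lnorm _ _ _).
by apply/funext => -[[x z] t].
Qed.

(** The first factor comes from [normc_unitary_group]; the inner 4 counts the maximal functions that
    are added. *)
Definition maximal_const s T : R :=
  4 * fourier_const ^+ 2 * (4 * schur_const (s / 3) T).

Lemma maximal_norm_le dir s T f : 3 / 2 < s -> 0 <= T -> sobolev s f ->
  (maximal_norm dir T (fun t => unitary_group t f)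
    <= (Num.sqrt (maximal_const s T))%:E * sobolev_norm s f)%E.
Proof.
move=> s32 T0 [[mf _] sf].
have a2 : 2^-1 < s / 3 by lra.
have s0 : 0 <= s by lra.
have mg := cmeasurable_fourier mf; have [mr mi] := mg.
have E0 : (0 <= sobolev_energy s f)%E.
  apply: integral_ge0 => w _; rewrite lee_fin mulr_ge0 ?powR_ge0//.
  by rewrite addr_ge0 ?sqr_ge0.
have Eoo : (sobolev_energy s f < +oo)%E.
  move: sf; rewrite sobolev_normE; case: (sobolev_energy s f) E0 => [r|//|//] _; first by move=> _; rewrite ltry.
  by rewrite /= invr_eq0 gt_eqF.
have Qr : (\int[leb3 R]_xi (fourier_re f xi ^+ 2 / wgt3 (s / 3) xi)%:E <= sobolev_energy s f)%E.
  by apply: weighted_le_energy => // w; rewrite lerDl sqr_ge0.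
have Qi : (\int[leb3 R]_xi (fourier_im f xi ^+ 2 / wgt3 (s / 3) xi)%:E <= sobolev_energy s f)%E.
  by apply: weighted_le_energy => // w; rewrite lerDr sqr_ge0.
have ir := weighted_integrable a2 mr (le_lt_trans Qr Eoo).
have ii := weighted_integrable a2 mi (le_lt_trans Qi Eoo).
have cif : cintegrable (fourier f) by split.
pose M1 := maximal_sqr dir T 0 (fourier_re f).
pose M2 := maximal_sqr dir T (- (pi / 2)) (fourier_im f).
pose M3 := maximal_sqr dir T 0 (fourier_im f).
pose M4 := maximal_sqr dir T (- (pi / 2)) (fourier_re f).
have mM1 : measurable_fun setT M1 by exact: measurable_maximal_sqr.
have mM2 : measurable_fun setT M2 by exact: measurable_maximal_sqr.
have mM3 : measurable_fun setT M3 by exact: measurable_maximal_sqr.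
have mM4 : measurable_fun setT M4 by exact: measurable_maximal_sqr.
have M10 x : (0 <= M1 x)%E by exact: maximal_sqr_ge0.
have M20 x : (0 <= M2 x)%E by exact: maximal_sqr_ge0.
have M30 x : (0 <= M3 x)%E by exact: maximal_sqr_ge0.
have M40 x : (0 <= M4 x)%E by exact: maximal_sqr_ge0.
have M0 x := adde_ge0 (adde_ge0 (adde_ge0 (M10 x) (M20 x)) (M30 x)) (M40 x).
have A0 := schur_const_gt0 T a2.
have IM b (h : R3 R -> R) : (leb3 R).-integrable setT (EFin \o h) ->
    (\int[leb3 R]_xi (h xi ^+ 2 / wgt3 (s / 3) xi)%:E <= sobolev_energy s f)%E ->
    (\int[mu]_x maximal_sqr dir T b h x <= (schur_const (s / 3) T)%:E * sobolev_energy s f)%E.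
  move=> jh Qh; apply: le_trans (integral_maximal_sqr dir b a2 T0 jh) _.
  by apply: lee_wpmul2l => //; rewrite lee_fin ltW.
pose H x := ((4 * fourier_const ^+ 2)%:E * (M1 x + M2 x + M3 x + M4 x))%E.
have K0 : 0 <= 4 * fourier_const ^+ 2 :> R by rewrite mulr_ge0// sqr_ge0.
have IH : (\int[mu]_x H x <= (maximal_const s T)%:E * sobolev_energy s f)%E.
  exact: (ge0_integral_sum4_le K0 (ltW A0) mM1 mM2 mM3 mM4 M10 M20 M30 M40
    (IM _ _ ir Qr) (IM _ _ ii Qi) (IM _ _ ii Qi) (IM _ _ ir Qr)).
have HM x : (`|Lnorm (leb_slab T) +oo
    (fun p : R3 R => (normc (unitary_group p.2 f (insert dir x p)))%:E)| `^ 2 <= H x)%E.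
  apply: Lnorm_slab_le; first by apply: mule_ge0; [rewrite lee_fin|exact: M0].
  move=> p pT; apply: (@le_trans _ _ (4 * fourier_const ^+ 2 *
    (osc_at dir 0 (fourier_re f) x p ^+ 2 +
     osc_at dir (- (pi / 2)) (fourier_im f) x p ^+ 2 +
     osc_at dir 0 (fourier_im f) x p ^+ 2 +
     osc_at dir (- (pi / 2)) (fourier_re f) x p ^+ 2))%:E).
    by rewrite lee_fin; exact: normc_unitary_group.
  rewrite EFinM lee_wpmul2l ?lee_fin// !EFinD.
  by do 3 (try apply: leeD); exact: osc_at_le_maximal.
rewrite sobolev_normE /maximal_norm Lnorm2E.
apply: (@le_trans _ _ (((maximal_const s T)%:E * sobolev_energy s f) `^ 2^-1)%E).
  apply: gt0_ler_poweR => //.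
  - by rewrite in_itv/= leey andbT integral_ge0// => x _; exact: poweR_ge0.
  - rewrite in_itv/= leey andbT mule_ge0 ?lee_fin//.
    by rewrite mulr_ge0// mulr_ge0// ltW.
  (* The inner norm is not known to be measurable in [x], whereas its majorant [H] is. *)
  - apply: le_trans IH; apply: ge0_le_integral_nonmeasurable => x; last exact: HM.
    exact: poweR_ge0.
rewrite poweRM//; last by rewrite lee_fin mulr_ge0// mulr_ge0// ltW.
by rewrite /= powR12_sqrt// mulr_ge0// mulr_ge0// ltW.
Qed.

End mixed_norm.

Local Close Scope complex_scope.
Local Close Scope classical_set_scope.

Theorem proposition2p2 (R : realType) (s T : R) (hs : 3 / 2 < s) (hT : 0 < T) :
  exists c : R, forall E0 : R3 R -> R[i], sobolev s E0 ->
    (norm_L2x_LinfyzT T (fun t => unitary_group t E0)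
       <= c%:E * sobolev_norm s E0)%E /\
    (norm_L2y_LinfxzT T (fun t => unitary_group t E0)
       <= c%:E * sobolev_norm s E0)%E.
Proof.
exists (Num.sqrt (maximal_const s T)) => E0 sE0.
rewrite norm_L2x_LinfyzTE norm_L2y_LinfxzTE.
by split; apply: maximal_norm_le => //; exact: ltW.
Qed.
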